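(* Let $d\ge 1$, $A\in\mathbb{R}^{d\times d}$, $z\in\mathbb{R}^d$, and let $\lambda=\max(1,\|A\|_\infty,\|A^\top\|_\infty)$, where $\|A\|_\infty=\max_{1\le i\le d}\sum_{j=1}^d|A_{ij}|$. Let $w$ be an $\mathbb{R}^d$-valued mean-zero stationary Gaussian process on $\mathbb{T}=(-R/\lambda,R/\lambda)$, with smooth autocovariance $\kappa(h)=\mathbb{E}[w_tw_{t+h}^\top]$. Assume that $\kappa$ is analytic around $0$ with radius of convergence $2R$, and that the sample paths of $w$ are analytic around $0$ almost surely. Then the unique solution on $\mathbb{T}$ of the linear equation $$\frac{d}{dt}x_t=Ax_t+w_t,\qquad x_0=z,$$ is a Gaussian process with mean $$\mathbb{E}[x_t]=e^{At}z$$ and autocovariance $$\operatorname{cov}(x_t,x_s)=\sum_{n,m=1}^{\infty}\frac{t^ns^m}{n!\,m!}\sum_{k=0}^{n-1}\sum_{l=0}^{m-1}A^{n-1-k}(-1)^k\kappa^{(k+l)}(0)(A^{m-1-l})^\top .$$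
   Context: The equation is understood pathwise: for almost every realisation of the noise it is an ordinary (inhomogeneous) differential equation. $\kappa^{(j)}$ denotes the $j$-th derivative of the $d\times d$ matrix-valued function $\kappa$. ''$\kappa$ is analytic around $0$ with radius of convergence $2R$'' means that the Taylor series of $\kappa$ at $0$ has radius of convergence $2R$, $R\in(0,\infty]$, and $\kappa$ equals this series on its domain intersected with $(-2R,2R)$; when $R=\infty$, $(-R/\lambda,R/\lambda)=\mathbb{R}$. $\operatorname{cov}(x_t,x_s)=\mathbb{E}[(x_t-\mathbb{E}x_t)(x_s-\mathbb{E}x_s)^\top]$. *)

(* Defs.v *)
From HB Require Import structures.
From mathcomp Require Import all_boot all_order all_algebra finmap.
From mathcomp Require Import all_classical all_reals all_analysis.
Import Order.TTheory GRing.Theory Num.Theory.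
Import numFieldNormedType.Exports.

Set Implicit Arguments.
Unset Strict Implicit.
Unset Printing Implicit Defensive.

Local Open Scope classical_set_scope.
Local Open Scope ring_scope.

Section series.
Context {R : realType} {V : normedModType R}.

Definition radius_of_convergence (a : nat -> V) : \bar R :=
  ereal_sup [set r%:E | r in
    [set r : R | 0 <= r /\ cvgn (series (fun n => r ^+ n *: a n))]].

Definition taylor_coef (f : R -> V) (n : nat) : V := (n`!%:R)^-1 *: (f^`(n))%classic 0.

(* [f^`(n)] is total, but [0 < r] together with the equality of [f] with its
   series makes [f] smooth near 0 when [D] is a neighbourhood of 0, so
   [taylor_coef] then never involves the derivative of a non-derivable map. *)
Definition analytic_around0 (D : set R) (f : R -> V) (r : \bar R) : Prop :=
  [/\ (0 < r)%E,
      radius_of_convergence (taylor_coef f) = r &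
      forall t, D t -> (`|t|%:E < r)%E ->
        series (fun n => t ^+ n *: taylor_coef f n) @ \oo --> f t].

Definition smooth_on (D : set R) (f : R -> V) : Prop :=
  forall n t, D t -> derivable (f^`(n))%classic t 1.

(* Unconditional convergence, i.e. along the net of finite sets of indices. *)
Definition has_sum (I : choiceType) (a : I -> V) (S : V) : Prop :=
  forall e : R, 0 < e -> exists F0 : {fset I}, forall F : {fset I},
    (F0 `<=` F)%fset -> `|S - \sum_(i <- F) a i| < e.

End series.

Section matrices.
Context {R : realType} {d : nat}.

(* The maximum is over a family of nonnegative reals, hence the base value 0. *)
Definition mx_norm_inf (A : 'M[R]_d) : R :=
  \big[Num.max/0]_(i < d) \sum_(j < d) `|A i j|.

Definition expmx (A : 'M[R]_d) : 'M[R]_d :=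
  limn (series (fun k => (k`!%:R)^-1 *: A ^+ k)).

Definition rate (A : 'M[R]_d) : R :=
  Num.max 1 (Num.max (mx_norm_inf A) (mx_norm_inf A^T)).

End matrices.

Section times.
Context {R : realType}.

(* [rho / lam] is computed in [\bar R], so this is the whole line for
   [rho = +oo]. *)
Definition time_interval (rho : \bar R) (lam : R) : set R :=
  [set t | (`|t|%:E < rho * lam^-1%:E)%E].

Definition lags (D : set R) : set R := [set h | exists t, D t /\ D (t + h)].

End times.

(* A process indexed by a set [D] of times is a map defined at all real times,
   whose values outside [D] are irrelevant. *)
Section processes.
Context {R : realType} {dOm : measure_display} {Om : measurableType dOm}.
Variable P : probability Om R.

(* Degenerate Gaussian laws are allowed; they need a separate case because
   [normal_prob m 0] is not the Dirac mass at [m]. *)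
Definition gaussian_rv (Y : Om -> R) : Prop :=
  measurable_fun setT Y /\
  exists m s : R, forall B : set R, measurable B ->
    P (Y @^-1` B) = if s == 0 then \d_m B else normal_prob m s B.

Variable d : nat.
Implicit Types X : R -> Om -> 'cV[R]_d.

(* The finite-dimensional vectors (X_{t_1}, ..., X_{t_n}) are Gaussian, that is,
   all their linear combinations are; one-term combinations give the
   measurability of the coordinates. *)
Definition gaussian_process (D : set R) X : Prop :=
  forall (n : nat) (t : 'I_n -> R) (c : 'I_n -> 'rV[R]_d),
    (forall k, D (t k)) ->
    gaussian_rv (fun om => \sum_(k < n) (c k *m X (t k) om) 0 0).

(* Equality of the joint laws is stated on the measurable boxes, which form a
   generating pi-system. *)
Definition stationary_process (D : set R) X : Prop :=
  forall (n : nat) (t : 'I_n -> R) (h : R) (B : 'I_n -> 'I_d -> set R),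
    (forall k, D (t k) /\ D (t k + h)) ->
    (forall k i, measurable (B k i)) ->
    P [set om | forall k i, B k i (X (t k) om i 0)] =
    P [set om | forall k i, B k i (X (t k + h) om i 0)].

Definition has_mean (Y : Om -> 'cV[R]_d) (m : 'cV[R]_d) : Prop :=
  forall i, 'E_P[(fun om => Y om i 0)%R]%E = (m i 0)%:E.

Definition has_cov (Y Z : Om -> 'cV[R]_d) (C : 'M[R]_d) : Prop :=
  forall i j,
    covariance P (fun om => Y om i 0) (fun om => Z om j 0) = (C i j)%:E.

Definition has_autocovariance (D : set R) X (kappa : R -> 'M[R]_d) : Prop :=
  forall t h, D t -> D (t + h) -> forall i j,
    'E_P[(fun om => X t om i 0 * X (t + h) om j 0)%R]%E = (kappa h i j)%:E.

Definition solves_linear_ode (D : set R) (A : 'M[R]_d) (z : 'cV[R]_d)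
    (w x : R -> Om -> 'cV[R]_d) : Prop :=
  {ae P, forall om, x 0 om = z /\
    forall t, D t -> is_derive t 1 (x ^~ om) (A *m x t om + w t om)}.

Definition indistinguishable (D : set R) (x y : R -> Om -> 'cV[R]_d) : Prop :=
  {ae P, forall om, forall t, D t -> x t om = y t om}.

End processes.

Definition cov_term {R : realType} {d : nat} (A : 'M[R]_d)
    (kappa : R -> 'M[R]_d) (t s : R) (n m : nat) : 'M[R]_d :=
  (t ^+ n * s ^+ m / (n`!%:R * m`!%:R)) *:
  \sum_(0 <= k < n) \sum_(0 <= l < m)
    (A ^+ (n - 1 - k) *m ((-1) ^+ k *: (kappa^`(k + l))%classic 0)
       *m (A ^+ (m - 1 - l))^T).

(* Main.v *)
Require Import Defs.
From HB Require Import structures.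
From mathcomp Require Import all_boot all_order all_algebra finmap.
From mathcomp Require Import all_classical all_reals all_analysis.
From mathcomp Require Import measurable_realfun normal_distribution.
From mathcomp Require Import ring lra zify.
Import Order.TTheory GRing.Theory Num.Theory.
Import numFieldNormedType.Exports.

Set Implicit Arguments.
Unset Strict Implicit.
Unset Printing Implicit Defensive.

Local Open Scope classical_set_scope.
Local Open Scope ring_scope.

(** Everything is governed by the derivatives W_k = w^(k)(0) of the noise at
    time 0.

    Pathwise, write w_t = sum_k t^k W_k / k! and look for x_t = sum_n t^n y_n.
    The equation is the recursion (n+1) y_(n+1) = A y_n + W_n / n!, so that
    x_t = e^(At) z + N_t with the response
    N_t = sum_(n >= 1) t^n / n! sum_(k < n) A^(n-1-k) W_k.
    The response is linear in the W_k, and since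
    E[W_k W_l^T] = (-1)^k kappa^(k+l)(0), the double series of the theorem is
    what bilinearity predicts for E[N_t N_s^T].

    The probabilistic content is one closure principle,
    [gaussian_family_lim].  A family of random variables is called Gaussian
    with kernel K when each finite linear combination sum_i c_i Y_i is a
    centred Gaussian of variance sum_(i,j) c_i c_j K i j.  If finite
    combinations of such a family converge almost surely and their kernels
    converge, then the limits are again a Gaussian family, for the limit
    kernel.  This reduces to one random variable at a time, where it holds
    because centred Gaussian laws are the laws of the multiples s Z of a single
    Z: when s_n tends to s, both Y_n and s_n Z converge, they have the same law
    for each n, hence so have their limits ([same_law_lim]).  The covariances of
    the limits come with it, by polarisation ([gaussian_family_cov]).

    The principle is applied twice: finite differences at 0 carry it from w to
    the W_k ([noise_deriv_family]), and partial sums carry it from the W_k to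
    the response ([response_family]).

    Two estimates make the series converge, both from
    (k+l)! <= 2^(k+l) k! l!.  For q in the time interval, kappa^(n)(0) / n! is
    O((2q)^(-n)), as the radius of convergence of kappa is twice R.
    First, E[W_k^2] = O((k! / q^k)^2), so that almost surely W_k q^k / k! is
    bounded ([ae_gbounded]); thus the Taylor series of the noise, a priori
    convergent only on a random neighbourhood of 0, represents it on the whole
    time interval.  Secondly, the terms of the double series are dominated by
    a product of two geometric sequences ([cov_term_bound]), so it converges
    unconditionally and is the limit of its square partial sums
    ([mx_has_sum]), which are the covariances of the partial sums of N.

    Uniqueness of the solution is Gronwall's inequality
    ([linear_ode_unique]). *)

(** * Random variables with the same law *)

Section same_law.
Context {R : realType}.

Definition same_law d1 (T1 : measurableType d1) (P : probability T1 R)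
    (Y : T1 -> R) d2 (T2 : measurableType d2) (Q : probability T2 R)
    (Z : T2 -> R) :=
  forall B : set R, measurable B -> P (Y @^-1` B) = Q (Z @^-1` B).

Context d1 (T1 : measurableType d1) (P : probability T1 R).
Context d2 (T2 : measurableType d2) (Q : probability T2 R).

(** Open half-lines form a pi-system generating the Borel sets. *)
Lemma same_law_cdf (Y : T1 -> R) (Z : T2 -> R) :
  measurable_fun setT Y -> measurable_fun setT Z ->
  (forall x, P (Y @^-1` `]-oo, x[) = Q (Z @^-1` `]-oo, x[)) ->
  same_law P Y Q Z.
Proof.
move=> mY mZ YZ B mB.
pose Ym := HB.pack_for {mfun T1 >-> R} Y (isMeasurableFun.Build _ _ _ _ _ mY).
pose Zm := HB.pack_for {mfun T2 >-> R} Z (isMeasurableFun.Build _ _ _ _ _ mZ).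
pose g (k : nat) : set R := `]-oo, k%:R[%classic.
apply: (@measure_unique _ R _ (@RGenInftyO.G R) g _ _ _ _
  (distribution P Ym) (distribution Q Zm)) => //.
- exact: RGenInftyO.measurableE.
- move=> A C [a ->] [b ->]; exists (Num.min a b).
  by apply/seteqP; split => x /=; rewrite !in_itv/= lt_min => /andP.
- by move=> k; exists k%:R.
- apply/seteqP; split => // x _.
  exists (Num.truncn `|x|).+1 => //=; rewrite /g/= in_itv/=.
  by rewrite (le_lt_trans (ler_norm x))// truncnS_gt.
- by move=> A [x ->]; exact: YZ.
- by move=> k; rewrite (le_lt_trans (probability_le1 _ _))// ?ltry//; exact: measurable_itv.
Qed.

Lemma same_law_ge0_integral (Y : T1 -> R) (Z : T2 -> R) (f : R -> \bar R) :
  measurable_fun setT Y -> measurable_fun setT Z -> same_law P Y Q Z ->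
  measurable_fun setT f -> (forall y, 0 <= f y)%E ->
  (\int[P]_x f (Y x) = \int[Q]_x f (Z x))%E.
Proof.
move=> mY mZ YZ mf f0.
have := @ge0_integral_pushforward _ _ _ _ _ _ mY P setT f measurableT mf (fun x _ => f0 x).
rewrite preimage_setT => <-.
have := @ge0_integral_pushforward _ _ _ _ _ _ mZ Q setT f measurableT mf (fun x _ => f0 x).
rewrite preimage_setT => <-.
pose Ym := HB.pack_for {mfun T1 >-> R} Y (isMeasurableFun.Build _ _ _ _ _ mY).
pose Zm := HB.pack_for {mfun T2 >-> R} Z (isMeasurableFun.Build _ _ _ _ _ mZ).
apply: (@eq_measure_integral _ _ _ _ (distribution Q Zm) (distribution P Ym)).
by move=> A mA _; exact: YZ.
Qed.

Lemma same_law_integrable (Y : T1 -> R) (Z : T2 -> R) (f : R -> R) :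
  measurable_fun setT Y -> measurable_fun setT Z -> same_law P Y Q Z ->
  measurable_fun setT f ->
  P.-integrable setT (EFin \o (f \o Y)) -> Q.-integrable setT (EFin \o (f \o Z)).
Proof.
move=> mY mZ YZ mf /integrableP[_ fi]; apply/integrableP; split.
  by apply/measurable_EFinP; exact: measurableT_comp.
move: fi; rewrite /=.
rewrite (@same_law_ge0_integral Y Z (fun y => `|(f y)%:E|%E))//.
by apply: measurableT_comp => //; exact/measurable_EFinP.
Qed.

Lemma same_law_integral (Y : T1 -> R) (Z : T2 -> R) (f : R -> R) :
  measurable_fun setT Y -> measurable_fun setT Z -> same_law P Y Q Z ->
  measurable_fun setT f ->
  (\int[P]_x (f (Y x))%:E = \int[Q]_x (f (Z x))%:E)%E.
Proof.
move=> mY mZ YZ mf.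
have mfE : measurable_fun setT (EFin \o f) by apply/measurable_EFinP.
rewrite integralE [RHS]integralE.
rewrite (funepos_comp (EFin \o f) Y) (funepos_comp (EFin \o f) Z).
rewrite (funeneg_comp (EFin \o f) Y) (funeneg_comp (EFin \o f) Z).
congr (_ - _)%E; apply: same_law_ge0_integral => //.
  exact: measurable_funepos.
exact: measurable_funeneg.
Qed.

(** The functions min(1, max(0, k (x - y))) of y are continuous and bounded, and
    increase to the indicator of y < x.  Dominated convergence, once along the
    sequences and once along k, compares the two distribution functions. *)
Lemma same_law_lim (Y_ : nat -> T1 -> R) (Y : T1 -> R) (Z_ : nat -> T2 -> R)
    (Z : T2 -> R) :
  (forall n, measurable_fun setT (Y_ n)) -> measurable_fun setT Y ->
  (forall n, measurable_fun setT (Z_ n)) -> measurable_fun setT Z ->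
  {ae P, forall x, Y_ ^~ x @ \oo --> Y x} ->
  {ae Q, forall x, Z_ ^~ x @ \oo --> Z x} ->
  (forall n, same_law P (Y_ n) Q (Z_ n)) -> same_law P Y Q Z.
Proof.
move=> mY_ mY mZ_ mZ cY cZ YZ; apply: same_law_cdf => // x.
pose f (k : nat) (y : R) := Num.min 1 (Num.max 0 (k%:R * (x - y))).
have cf k : continuous (f k).
  move=> y; apply: (@continuous_min _ _ (cst 1) (fun y => Num.max 0 (k%:R * (x - y)))).
    exact: cvg_cst.
  apply: (@continuous_max _ _ (cst 0) (fun y => k%:R * (x - y))).
    exact: cvg_cst.
  apply: cvgM; first exact: cvg_cst.
  by apply: cvgB; [exact: cvg_cst|exact: cvg_id].
have mf k : measurable_fun setT (f k) by exact: continuous_measurable_fun.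
have f01 k y : 0 <= f k y <= 1.
  by rewrite /f le_min ler01 le_max lexx/= ge_min lexx.
have lim_int d (T : measurableType d) (M : probability T R)
    (g_ : nat -> T -> R) (g : T -> R) : 
    (forall n, measurable_fun setT (g_ n)) -> measurable_fun setT g ->
    (forall n x, 0 <= g_ n x <= 1) ->
    {ae M, forall x, g_ ^~ x @ \oo --> g x} ->
    (\int[M]_x (g_ n x)%:E)%E @[n --> \oo] --> (\int[M]_x (g x)%:E)%E.
  move=> mg_ mg g01 cg.
  have [] // := @dominated_convergence _ T R M setT measurableT
    (fun n x => (g_ n x)%:E) (fun x => (g x)%:E) (cst 1%E).
  - by move=> n; exact/measurable_EFinP.
  - exact/measurable_EFinP.
  - apply: filterS cg => y gy _; apply: cvg_EFin gy.
    by near=> n.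
  - exact: finite_measure_integrable_cst.
  - apply: aeW => y n _ /=; rewrite lee_fin ger0_norm; by have /andP[] := g01 n y.
have indic_lim d (T : measurableType d) (M : probability T R) (V : T -> R) :
    measurable_fun setT V ->
    (\int[M]_t (f k (V t))%:E)%E @[k --> \oo] --> M (V @^-1` `]-oo, x[).
  move=> mV.
  have mA : measurable (V @^-1` `]-oo, x[).
    by rewrite -[_ @^-1` _]setTI; apply: mV.
  have -> : M (V @^-1` `]-oo, x[) = (\int[M]_t (\1_(V @^-1` `]-oo, x[) t)%:E)%E.
    by rewrite integral_indic// setIT.
  apply: lim_int => //.
  - by move=> k; exact: measurableT_comp.
  - apply: aeW => t; rewrite indicE; apply: cvg_near_cst; near=> k.
    rewrite /f /=; case: (ltP (V t) x) => Vx.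
      rewrite mem_set/= ?in_itv//=.
      have : 1 <= k%:R * (x - V t).
        rewrite -ler_pdivrMr ?subr_gt0// div1r.
        by near: k; exact: nbhs_infty_ger.
      move=> h; rewrite max_r ?min_l//; first by rewrite (le_trans _ h).
    rewrite memNset/= ?in_itv/=; last by apply/negP; rewrite -leNgt.
    rewrite max_l ?min_r//.
    by rewrite mulr_ge0_le0// subr_le0.
have E k : (\int[P]_t (f k (Y t))%:E = \int[Q]_t (f k (Z t))%:E)%E.
  have h1 : (\int[P]_t (f k (Y_ n t))%:E)%E @[n --> \oo] --> (\int[P]_t (f k (Y t))%:E)%E.
    apply: lim_int => //.
    - by move=> n; exact: measurableT_comp.
    - exact: measurableT_comp.
    - by apply: filterS cY => t ct; apply: (cvg_comp _ (f k) ct); exact: cf.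
  have h2 : (\int[Q]_t (f k (Z_ n t))%:E)%E @[n --> \oo] --> (\int[Q]_t (f k (Z t))%:E)%E.
    apply: lim_int => //.
    - by move=> n; exact: measurableT_comp.
    - exact: measurableT_comp.
    - by apply: filterS cZ => t ct; apply: (cvg_comp _ (f k) ct); exact: cf.
  have e : (fun n => \int[P]_t (f k (Y_ n t))%:E)%E = (fun n => \int[Q]_t (f k (Z_ n t))%:E)%E.
    by apply/funext => n; exact: same_law_integral.
  by rewrite -e in h2; apply: cvg_unique h1 h2.
have hY := indic_lim _ _ P Y mY; have hZ := indic_lim _ _ Q Z mZ.
have e : (fun k => \int[P]_t (f k (Y t))%:E)%E = (fun k => \int[Q]_t (f k (Z t))%:E)%E.
  exact/funext.
by rewrite -e in hZ; apply: cvg_unique hY hZ.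
Unshelve. all: by end_near. Qed.

End same_law.

(** * The normal law *)

Section normal.
Context {R : realType}.

Local Notation gauss := (@normal_prob R 0 1 : probability (measurableTypeR R) R).

Lemma normal_pdf_affine (m s u : R) : 0 < s ->
  normal_pdf m s (m + s * u) * s = normal_pdf 0 1 u.
Proof.
move=> s0.
have s0' : s != 0 by rewrite gt_eqF.
rewrite !normal_pdfE ?oner_neq0//.
rewrite /normal_peak /normal_fun mulrC mulrA; congr (_ * expR _).
  rewrite -mulrnAr sqrtrM ?sqr_ge0// sqrtr_sqr gtr0_norm// invfM mulVKf//.
  by rewrite expr1n mul1r.
by rewrite subr0 (addrC m) addrK expr1n; field.
Qed.

Lemma affine_derive1 (m s : R) : (fun u : R^o => m + s * u)^`()%classic = cst s.
Proof.
apply/funext => x; rewrite derive1E deriveD// derive_cst add0r deriveM//.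
by rewrite derive_id derive_cst scaler0 addr0 scaler1.
Qed.

(** Reduces all normal laws to the standard one, so that moments and limits are
    computed for affine functions of a single variable. *)
Lemma normal_law_affine (m s : R) : 0 < s ->
  same_law (@normal_prob R m s : probability (measurableTypeR R) R) id
    gauss (fun u => m + s * u).
Proof.
move=> s0; apply: same_law_cdf => // [|x].
  by apply: measurable_funD => //; apply: measurable_funM.
have -> : (fun u => m + s * u) @^-1` `]-oo, x[ = `]-oo, (x - m) / s[%classic.
  apply/seteqP; split => u /=; rewrite !in_itv/= ltr_pdivlMr// ltrBrDl mulrC//.
rewrite preimage_id /= /normal_prob.
have mp (a b : R) : measurable_fun setT (EFin \o normal_pdf a b).
  by apply/measurable_EFinP; exact: measurable_normal_pdf.
have opn (a b y : R) : (\int[lebesgue_measure]_(x in `]-oo, y[) (normal_pdf a b x)%:E =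
   \int[lebesgue_measure]_(x in `]-oo, y]) (normal_pdf a b x)%:E)%E.
  by rewrite integral_itv_bndo_bndc//; exact: measurable_funTS (mp a b).
rewrite !opn.
have -> : x = m + s * ((x - m) / s) by field; rewrite gt_eqF.
set b := (X in m + s * X).
rewrite (_ : (m + s * b - m) / s = b); last by field; rewrite gt_eqF.
rewrite (@increasing_ge0_integration_by_substitutionNy _ (fun u => m + s * u)).
- apply: eq_integral => u _; rewrite affine_derive1 /= !fctE.
  by rewrite normal_pdf_affine.
- by move=> u v _ _ uv; rewrite ltrD2l ltr_pM2l.
- by move=> u _; rewrite affine_derive1; exact: cvg_cst.
- by rewrite affine_derive1; exact: is_cvg_cst.
- by rewrite affine_derive1; exact: cvg_cst.
- split => //.
  apply: cvg_at_left_filter.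
  by apply: cvgD; [exact: cvg_cst|apply: cvgM; [exact: cvg_cst|exact: cvg_id]].
- apply/cvgrNyPle => M; exists ((M - m) / s); split; first exact: num_real.
  by move=> u; rewrite ltr_pdivlMr// ltrBrDl (mulrC u) => /ltW.
- apply: continuous_subspaceT; apply: continuous_normal_pdf; by rewrite gt_eqF.
- by move=> u _; exact: normal_pdf_ge0.
Qed.

Lemma gauss_sym : same_law gauss id gauss (-%R).
Proof.
move=> B mB; rewrite preimage_id /= /normal_prob.
have mp : measurable_fun setT (EFin \o normal_pdf (0:R) 1).
  by apply/measurable_EFinP; exact: measurable_normal_pdf.
have mN : measurable_fun setT (-%R : measurableTypeR R -> measurableTypeR R).
  exact: oppr_measurable.
transitivity (\int[pushforward lebesgue_measure
    (-%R : measurableTypeR R -> measurableTypeR R)]_(x in B) (normal_pdf 0 1 x)%:E)%E.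
  by apply: eq_measure_integral => //= A mA AB; exact/esym/lebesgue_measureN.
rewrite (ge0_integral_pushforward mN) //=.
- apply: eq_integral => x _ /=; congr EFin.
  rewrite !normal_pdfE ?oner_neq0//; congr (_ * expR _).
  by rewrite !subr0 sqrrN.
- exact: measurable_funTS mp.
- by move=> x _; rewrite lee_fin normal_pdf_ge0.
Qed.

Lemma gauss_integral (f : R -> \bar R) : measurable_fun setT f ->
  (forall x, 0 <= f x)%E ->
  (\int[gauss]_x f x = \int[lebesgue_measure]_x (f x * (normal_pdf 0 1 x)%:E))%E.
Proof.
move=> mf f0.
have dom := @normal_prob_dominates R 0 1.
have mp : measurable_fun setT (EFin \o normal_pdf (0:R) 1).
  by apply/measurable_EFinP; exact: measurable_normal_pdf.
rewrite -(Radon_Nikodym_SigmaFinite.change_of_variables dom)//.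
apply: ae_eq_integral => //.
- apply: emeasurable_funM => //.
  exact: measurable_int (Radon_Nikodym_SigmaFinite.f_integrable dom).
- exact: emeasurable_funM.
- apply: ae_eqe_mul2l; apply: integral_ae_eq => //.
  + exact: Radon_Nikodym_SigmaFinite.f_integrable.
  + by move=> E _ mE; rewrite -(Radon_Nikodym_SigmaFinite.f_integral dom).
Qed.

(** The factor u^2 costs only a widening of the bell: u^2 <= 4 e^(u^2 / 4)
    turns the standard density into a multiple of the one of variance 2. *)
Lemma gauss_sq_integrable : gauss.-integrable setT (fun u => (u ^+ 2)%:E).
Proof.
have msq : measurable_fun setT (fun u : R => (u ^+ 2)%:E).
  by apply/measurable_EFinP; exact: measurable_funX.
apply/integrableP; split => //.
under eq_integral do rewrite gee0_abs ?lee_fin ?sqr_ge0//.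
rewrite gauss_integral//; last by move=> x; rewrite lee_fin sqr_ge0.
(* the standard deviation of the wider bell *)
pose s : R := Num.sqrt 2.
have s0 : s != 0 by rewrite gt_eqF// sqrtr_gt0.
have s2 : s ^+ 2 = 2 by rewrite sqr_sqrtr.
pose c : R := 4 * normal_peak 1 / normal_peak s.
have c0 : 0 <= c.
  by rewrite !mulr_ge0 ?invr_ge0 ?normal_peak_ge0.
apply: (@le_lt_trans _ _ (\int[lebesgue_measure]_x (c%:E * (normal_pdf 0 s x)%:E))%E).
  apply: ge0_le_integral => //.
  - by move=> x _; rewrite -EFinM lee_fin mulr_ge0 ?sqr_ge0 ?normal_pdf_ge0.
  - apply: emeasurable_funM => //.
    by apply/measurable_EFinP; exact: measurable_normal_pdf.
  - apply: emeasurable_funM => //.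
    by apply/measurable_EFinP; exact: measurable_normal_pdf.
  - move=> x _; rewrite -!EFinM lee_fin !normal_pdfE ?oner_neq0//.
    have -> : c * (normal_peak s * normal_fun 0 s x) =
        normal_peak 1 * (4 * normal_fun 0 s x).
      by rewrite /c mulrA divfK ?gt_eqF ?normal_peak_gt0// (mulrC 4) mulrA.
    rewrite mulrCA ler_wpM2l ?normal_peak_ge0//.
    rewrite /normal_fun !subr0 s2 expr1n.
    have -> : - x ^+ 2 / (1 *+ 2) = - x ^+ 2 / (2 *+ 2) + - (x ^+ 2 / 4) by field.
    rewrite expRD mulrCA [leRHS]mulrC ler_wpM2l ?expR_ge0//.
    rewrite expRN ler_pdivrMr ?expR_gt0//.
    have := expR_ge1Dx (x ^+ 2 / 4).
    by have := sqr_ge0 x; lra.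
rewrite integralZl//; last exact: integrable_normal_pdf.
by rewrite integral_normal_pdf mule1 ltry.
Qed.

Lemma gauss_integrable : gauss.-integrable setT (fun u => u%:E).
Proof.
have i1 : gauss.-integrable setT (fun u => (u ^+ 2 + 1)%:E).
  under eq_fun do rewrite EFinD.
  apply: integrableD => //; first exact: gauss_sq_integrable.
  exact: finite_measure_integrable_cst.
apply: le_integrable i1 => //.
  by apply/measurable_EFinP; exact: measurable_id.
move=> u _ /=; rewrite lee_fin [leRHS]ger0_norm ?addr_ge0 ?sqr_ge0//.
rewrite -[u ^+ 2]real_normK ?num_real//.
by have := sqr_ge0 (`|u| - 1); have := normr_ge0 u; nra.
Qed.

(** The second moment of the standard normal law.  It is kept as a symbol: it
    serves as the unit in which variances are measured. *)
Definition gauss_var : R := fine (\int[gauss]_u (u ^+ 2)%:E)%E.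

Lemma gauss_varE : (\int[gauss]_u (u ^+ 2)%:E = gauss_var%:E)%E.
Proof.
by rewrite fineK// integrable_fin_num//; exact: gauss_sq_integrable.
Qed.

Lemma gauss_mean : (\int[gauss]_u u%:E = 0)%E.
Proof.
have mid : measurable_fun setT (id : R -> R) by exact: measurable_id.
have h := @same_law_integral _ _ _ gauss _ _ gauss _ _ id (@measurable_id _ _ setT)
  (@oppr_measurable R setT) gauss_sym mid.
have fi : (\int[gauss]_u u%:E)%E \is a fin_num.
  by apply: integrable_fin_num => //; exact: gauss_integrable.
move: h; under [X in _ = X -> _]eq_integral do rewrite /= EFinN.
rewrite integralN; last exact: integrable_add_def gauss_integrable.
rewrite /= -(fineK fi) => -[] h; congr EFin; lra.
Qed.

(** A vanishing second moment would concentrate the law at 0, which is a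
    Lebesgue-null set. *)
Lemma gauss_var_gt0 : 0 < gauss_var.
Proof.
rewrite lt_neqAle -lee_fin -gauss_varE; apply/andP; split; last first.
  by apply: integral_ge0 => x _; rewrite lee_fin sqr_ge0.
apply/negP => /eqP v0.
have msq : measurable_fun setT (fun u : R => (u ^+ 2)%:E).
  by apply/measurable_EFinP; exact: measurable_funX.
have : (\int[gauss]_x `|(x ^+ 2)%:E| = 0)%E.
  under eq_integral do rewrite gee0_abs ?lee_fin ?sqr_ge0//.
  by rewrite gauss_varE -v0.
move/(ae_eq_integral_abs gauss measurableT msq) => [N [mN N0 sN]].
have g0 : gauss [set 0] = 0%E.
  move/null_content_dominatesP : (@normal_prob_dominates R 0 1) => dom.
  by apply: dom; [exact: measurable_set1|exact: lebesgue_measure_set1].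
have : gauss (N `|` [set 0]) = 1%E.
  rewrite -(probability_setT gauss); congr (gauss _).
  apply/seteqP; split => // x _; have [->|x0] := eqVneq x 0; first by right.
  left; apply: sN => /= /(_ Logic.I) []; exact/eqP/expf_neq0.
rewrite null_set_setU//.
by move=> /esym/eqP; rewrite eqe oner_eq0.
Qed.

End normal.

(** * Centred Gaussian random variables *)

Section centered_gaussian.
Context {R : realType} {dOm : measure_display} {Om : measurableType dOm}.
Variable P : probability Om R.
Local Notation gauss := (@normal_prob R 0 1 : probability (measurableTypeR R) R).

Definition sdev (v : R) : R := Num.sqrt (v / @gauss_var R).

(** Describing the law as that of a multiple of a standard normal variable
    covers the degenerate case [v = 0] without a case distinction. *)
Definition centered_gaussian (v : R) (Y : Om -> R) : Prop :=
  [/\ measurable_fun setT Y, 0 <= v & same_law P Y gauss (fun u => sdev v * u)].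

Lemma sdev_sqr v : 0 <= v -> sdev v ^+ 2 * @gauss_var R = v.
Proof.
move=> v0; have g0 := @gauss_var_gt0 R.
by rewrite sqr_sqrtr ?divr_ge0 ?(ltW g0)// divfK ?gt_eqF.
Qed.

Lemma measurable_affine (m s : R) : measurable_fun setT (fun u : R => m + s * u).
Proof. by apply: measurable_funD => //; exact: measurable_funM. Qed.

Lemma measurable_scale (s : R) : measurable_fun setT (fun u : R => s * u).
Proof. exact: measurable_funM. Qed.

Lemma measurable_sqr : measurable_fun setT (fun u : R => u ^+ 2).
Proof. exact: measurable_funX. Qed.

Lemma centered_gaussian_integrable v Y : centered_gaussian v Y ->
  P.-integrable setT (EFin \o Y).
Proof.
case=> mY v0 law.
have law' : same_law gauss (fun u => sdev v * u) P Y by move=> B mB; rewrite law.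
have := @same_law_integrable _ _ _ gauss _ _ P _ _ id (measurable_scale _) mY law'.
apply; first exact: measurable_id.
have -> : (EFin \o (id \o (fun u : R => sdev v * u))) = (fun u => (sdev v)%:E * u%:E)%E.
  by apply/funext => u /=; rewrite EFinM.
apply: integrableZl => //; exact: gauss_integrable.
Qed.

Lemma centered_gaussian_sqr_integrable v Y : centered_gaussian v Y ->
  P.-integrable setT (fun x => (Y x ^+ 2)%:E).
Proof.
case=> mY v0 law.
have law' : same_law gauss (fun u => sdev v * u) P Y by move=> B mB; rewrite law.
have := @same_law_integrable _ _ _ gauss _ _ P _ _ (fun u => u ^+ 2)
  (measurable_scale _) mY law' measurable_sqr.
apply.
have -> : (EFin \o ((fun u : R => u ^+ 2) \o (fun u : R => sdev v * u))) =
   (fun u => (sdev v ^+ 2)%:E * (u ^+ 2)%:E)%E.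
  by apply/funext => u /=; rewrite exprMn EFinM.
apply: integrableZl => //; exact: gauss_sq_integrable.
Qed.

Lemma centered_gaussian_mean v Y : centered_gaussian v Y ->
  (\int[P]_x (Y x)%:E = 0)%E.
Proof.
case=> mY v0 law.
rewrite (@same_law_integral _ _ _ P _ _ gauss _ _ id mY (measurable_scale _) law);
  last exact: measurable_id.
under eq_integral do rewrite /= EFinM.
rewrite integralZl//; last exact: gauss_integrable.
by rewrite gauss_mean mule0.
Qed.

Lemma centered_gaussian_variance v Y : centered_gaussian v Y ->
  (\int[P]_x (Y x ^+ 2)%:E = v%:E)%E.
Proof.
case=> mY v0 law.
rewrite (@same_law_integral _ _ _ P _ _ gauss _ _ (fun u => u ^+ 2) mY
  (measurable_scale _) law measurable_sqr).
under eq_integral do rewrite /= exprMn EFinM.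
rewrite integralZl//; last exact: gauss_sq_integrable.
by rewrite gauss_varE -EFinM sdev_sqr.
Qed.

Lemma gaussian_rv_law Y : gaussian_rv P Y ->
  exists m s : R, 0 <= s /\ same_law P Y gauss (fun u => m + s * u).
Proof.
case=> mY [m [s h]]; exists m, `|s|; split=> // B mB.
rewrite h//; have [->|s0] := eqVneq s 0.
  rewrite normr0; under [X in X @^-1` _]eq_fun do rewrite mul0r addr0.
  rewrite diracE; have [Bm|Bm] := boolP (m \in B).
    rewrite (_ : _ @^-1` _ = setT) ?probability_setT//.
    by apply/seteqP; split => // x _ /=; rewrite inE in Bm.
  rewrite (_ : _ @^-1` _ = set0) ?measure0//.
  by apply/seteqP; split => // x /=; rewrite notin_setE in Bm.
have s1 : 0 < `|s| by rewrite normr_gt0.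
have <- := @normal_law_affine R m `|s| s1 B mB.
rewrite preimage_id; apply: eq_integral => x _; congr EFin.
by rewrite !normal_pdfE ?normr_eq0// /normal_peak /normal_fun real_normK ?num_real.
Qed.

(** The first two moments determine both parameters of the law. *)
Lemma gaussian_rv_centered Y v : gaussian_rv P Y ->
  (\int[P]_x (Y x)%:E = 0)%E -> (\int[P]_x (Y x ^+ 2)%:E = v%:E)%E ->
  centered_gaussian v Y.
Proof.
move=> gY EY EY2; have [mY _] := gY.
have [m [s [s0 law]]] := gaussian_rv_law gY.
have m0 : m = 0.
  move: EY; rewrite (@same_law_integral _ _ _ P _ _ gauss _ _ id mY
    (measurable_affine _ _) law); last exact: measurable_id.
  under eq_integral do rewrite /= EFinD EFinM.
  rewrite integralD//=; last 2 first.
    exact: finite_measure_integrable_cst.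
    by apply: integrableZl => //; exact: gauss_integrable.
  rewrite integral_cst// [X in (_ * X)%E](_ : _ = 1%E);
    last exact: (probability_setT gauss).
  rewrite mule1 integralZl//; last exact: gauss_integrable.
  by rewrite gauss_mean mule0 adde0 => -[].
have {}law : same_law P Y gauss (fun u => s * u).
  move=> B mB; rewrite law// m0.
  by under [X in X @^-1` _]eq_fun do rewrite add0r.
have g0 := @gauss_var_gt0 R.
have vE : s ^+ 2 * @gauss_var R = v.
  move: EY2; rewrite (@same_law_integral _ _ _ P _ _ gauss _ _ (fun u => u ^+ 2) mY
    (measurable_scale _) law measurable_sqr).
  under eq_integral do rewrite /= exprMn EFinM.
  rewrite integralZl//; last exact: gauss_sq_integrable.
  rewrite gauss_varE -EFinM => h; exact: EFin_inj h.
split=> //; first by rewrite -vE mulr_ge0 ?sqr_ge0 ?ltW.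
by rewrite /sdev -vE mulfK ?gt_eqF// sqrtr_sqr ger0_norm.
Qed.

Lemma centered_gaussian_shift v Y (a : R) : centered_gaussian v Y ->
  gaussian_rv P (fun x => a + Y x).
Proof.
case=> mY v0 law; split; first exact: measurable_funD.
exists a, (sdev v) => B mB.
have E : P ((fun x => a + Y x) @^-1` B) = gauss ((fun u => a + sdev v * u) @^-1` B).
  have mB' : measurable ((fun y : R => a + y) @^-1` B).
    by rewrite -[_ @^-1` _]setTI; apply: measurable_funD.
  exact: (law _ mB').
rewrite E; case: eqVneq => [->|s0].
  under [X in X @^-1` _]eq_fun do rewrite mul0r addr0.
  rewrite diracE; have [Bm|Bm] := boolP (a \in B).
    rewrite (_ : _ @^-1` _ = setT) ?probability_setT//.
    by apply/seteqP; split => // x _ /=; rewrite inE in Bm.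
  rewrite (_ : _ @^-1` _ = set0) ?measure0//.
  by apply/seteqP; split => // x /=; rewrite notin_setE in Bm.
have s1 : 0 < sdev v by rewrite lt_neqAle eq_sym s0 sqrtr_ge0.
by have := @normal_law_affine R a (sdev v) s1 B mB; rewrite preimage_id.
Qed.

(** [Y_ n] has the law of [sdev (v_ n) * u], and these multiples of [u] converge
    everywhere. *)
Lemma centered_gaussian_lim (v_ : nat -> R) (v : R) (Y_ : nat -> Om -> R)
    (Y : Om -> R) :
  (\forall n \near \oo, centered_gaussian (v_ n) (Y_ n)) -> v_ @ \oo --> v ->
  measurable_fun setT Y -> {ae P, forall x, Y_ ^~ x @ \oo --> Y x} ->
  centered_gaussian v Y.
Proof.
case=> N _ gY cv mY cY.
pose vN n := v_ (n + N)%N; pose YN n := Y_ (n + N)%N.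
have gN n : centered_gaussian (vN n) (YN n) by apply: gY => /=; exact: leq_addl.
have {}cv : vN @ \oo --> v by rewrite /vN (cvg_shiftn N v_).
split => //.
  rewrite -(cvg_lim _ cv)//; apply: limr_ge; first by apply/cvg_ex; exists v.
  by near=> n; have [] := gN n.
apply: (@same_law_lim _ _ _ P _ _ gauss YN Y (fun n u => sdev (vN n) * u)) => //.
- by move=> n; have [] := gN n.
- by move=> n; exact: measurable_scale.
- exact: measurable_scale.
- by apply: filterS cY => x cx; rewrite /YN (cvg_shiftn N (Y_ ^~ x)).
- apply: aeW => u; apply: cvgMl.
  apply: (@cvg_comp _ _ _ (fun n => vN n / gauss_var) Num.sqrt _ (nbhs (v / gauss_var))).
    exact: cvgMl.
  exact: sqrt_continuous.
- by move=> n; have [] := gN n.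
Unshelve. all: by end_near. Qed.

End centered_gaussian.

(** * Gaussian families and their limits *)

Section combinations.
Context {R : realType}.

Definition comb (I T : Type) (l : seq (R * I)) (Y : I -> T -> R) (om : T) : R :=
  \sum_(p <- l) p.1 * Y p.2 om.

Definition quad (I : Type) (K : I -> I -> R) (l l' : seq (R * I)) : R :=
  \sum_(p <- l) \sum_(q <- l') p.1 * q.1 * K p.2 q.2.

(** Substitution of combinations for the variables of a combination: a
    combination of combinations is flattened into a single list. *)
Definition comb_bind (I J : Type) (L : J -> seq (R * I)) (m : seq (R * J)) :
    seq (R * I) :=
  flatten [seq [seq (p.1 * q.1, q.2) | q <- L p.2] | p <- m].

Definition indexed_in (I : eqType) (D : set I) (l : seq (R * I)) : Prop :=
  forall p, p \in l -> D p.2.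

Lemma comb_bindE (I J T : Type) (L : J -> seq (R * I)) m (Y : I -> T -> R) om :
  comb (comb_bind L m) Y om = \sum_(p <- m) p.1 * comb (L p.2) Y om.
Proof.
rewrite /comb /comb_bind big_flatten big_map; apply: eq_bigr => p _.
by rewrite big_map mulr_sumr; apply: eq_bigr => q _; rewrite mulrA.
Qed.

Lemma quad_bindE (I J : Type) (K : I -> I -> R) (L : J -> seq (R * I)) m m' :
  quad K (comb_bind L m) (comb_bind L m') =
  quad (fun j j' => quad K (L j) (L j')) m m'.
Proof.
rewrite /quad /comb_bind big_flatten big_map; apply: eq_bigr => p _.
under eq_bigr do rewrite big_flatten big_map.
rewrite exchange_big/=; apply: eq_bigr => q _.
rewrite big_map mulr_sumr; apply: eq_bigr => a _ /=.
by rewrite big_map mulr_sumr; apply: eq_bigr => b _ /=; rewrite !mulrA (mulrAC p.1).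
Qed.

Lemma quad_sym (I : eqType) (D : set I) (K : I -> I -> R) l l' :
  (forall i j, D i -> D j -> K i j = K j i) ->
  indexed_in D l -> indexed_in D l' -> quad K l l' = quad K l' l.
Proof.
move=> sK Dl Dl'; rewrite /quad exchange_big/=.
rewrite big_seq [RHS]big_seq; apply: eq_bigr => q ql.
rewrite big_seq [RHS]big_seq; apply: eq_bigr => p pl.
by rewrite (mulrC q.1) (sK _ _ (Dl _ pl) (Dl' _ ql)).
Qed.

Lemma cvg_sum_seq (I : eqType) (l : seq I) (f : nat -> I -> R) (g : I -> R) :
  (forall i, i \in l -> f ^~ i @ \oo --> g i) ->
  (fun n => \sum_(i <- l) f n i) @ \oo --> \sum_(i <- l) g i.
Proof.
elim: l => [|i l ih] h.
  by under eq_fun do rewrite big_nil; rewrite big_nil; exact: cvg_cst.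
under eq_fun do rewrite big_cons; rewrite big_cons; apply: cvgD.
  by apply: h; rewrite mem_head.
by apply: ih => j jl; apply: h; rewrite in_cons jl orbT.
Qed.

End combinations.

Section gaussian_family.
Context {R : realType} {dOm : measure_display} {Om : measurableType dOm}.
Variable P : probability Om R.

(** Prescribing the laws of all finite combinations encodes joint Gaussianity,
    centring and the covariances at once. *)
Definition gaussian_family (I : eqType) (D : set I) (Y : I -> Om -> R)
    (K : I -> I -> R) : Prop :=
  (forall i j, D i -> D j -> K i j = K j i) /\
  forall l, indexed_in D l -> centered_gaussian P (quad K l l) (comb l Y).

Section basic.
Context (I : eqType) (D : set I) (Y : I -> Om -> R) (K : I -> I -> R).
Hypothesis gY : gaussian_family D Y K.

Lemma gaussian_family1 i : D i -> centered_gaussian P (K i i) (Y i).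
Proof.
move=> Di; have [_ h] := gY; have /h : indexed_in D [:: (1 : R, i)].
  by move=> p; rewrite inE => /eqP ->.
rewrite /quad !big_seq1 /= !mul1r /comb.
by under eq_fun do rewrite big_seq1 mul1r.
Qed.

Lemma gaussian_family2 i j : D i -> D j ->
  centered_gaussian P (K i i + K j j + 2 * K i j) (Y i \+ Y j).
Proof.
move=> Di Dj; have [sK h] := gY; have /h : indexed_in D [:: (1 : R, i); (1, j)].
  by move=> p; rewrite !inE => /orP[] /eqP ->.
rewrite /quad !big_cons !big_nil /= !mul1r /comb !addr0 (sK j i)//.
rewrite (_ : _ + _ + _ = K i i + K j j + 2 * K i j); last by ring.
by under eq_fun do rewrite !big_cons big_nil /= !mul1r addr0.
Qed.

(** Polarisation: 2 Y_i Y_j = (Y_i + Y_j)^2 - Y_i^2 - Y_j^2. *)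
Lemma gaussian_family_cov i j : D i -> D j ->
  P.-integrable setT (fun x => (Y i x * Y j x)%:E) /\
  (\int[P]_x (Y i x * Y j x)%:E = (K i j)%:E)%E.
Proof.
move=> Di Dj.
have gi := gaussian_family1 Di; have gj := gaussian_family1 Dj.
have gij := gaussian_family2 Di Dj.
have ii := centered_gaussian_sqr_integrable gi.
have ij := centered_gaussian_sqr_integrable gj.
have iij := centered_gaussian_sqr_integrable gij.
have E : (fun x => (Y i x * Y j x)%:E) = (fun x => (2^-1)%:E *
   ((((Y i \+ Y j) x) ^+ 2)%:E - (Y i x ^+ 2)%:E - (Y j x ^+ 2)%:E))%E.
  apply/funext => x; rewrite -!EFinB -EFinM; congr EFin => /=; by field.
have i1 : P.-integrable setT
    (fun x => ((((Y i \+ Y j) x) ^+ 2)%:E - (Y i x ^+ 2)%:E)%E).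
  exact: integrableB.
have i2 : P.-integrable setT
    (fun x => ((((Y i \+ Y j) x) ^+ 2)%:E - (Y i x ^+ 2)%:E - (Y j x ^+ 2)%:E)%E).
  exact: integrableB.
split; first by rewrite E; exact: integrableZl.
rewrite E integralZl// integralB// integralB//.
rewrite (centered_gaussian_variance gi) (centered_gaussian_variance gj).
rewrite (centered_gaussian_variance gij) -!EFinB -EFinM; congr EFin; by field.
Qed.

End basic.

Lemma measurable_comb (I : eqType) (m : seq (R * I)) (Z : I -> Om -> R) :
  (forall p, p \in m -> measurable_fun setT (Z p.2)) ->
  measurable_fun setT (comb m Z).
Proof.
elim: m => [|p m ih] h; rewrite /comb.
  by under eq_fun do rewrite big_nil; exact: measurable_cst.
under eq_fun do rewrite big_cons; apply: measurable_funD.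
  by apply: measurable_funM => //; apply: h; rewrite mem_head.
by apply: ih => q qm; apply: h; rewrite in_cons qm orbT.
Qed.

(** A combination of the limits is the almost sure limit of combinations of the
    given family, whose variances converge by bilinearity.  The indices of the
    approximating combinations may leave [D] for finitely many [n], as happens
    with difference quotients whose step is still too large. *)
Lemma gaussian_family_lim (I J : eqType) (D : set I) (E : set J)
    (Y : I -> Om -> R) (K : I -> I -> R) (Z : J -> Om -> R) (K' : J -> J -> R)
    (L : nat -> J -> seq (R * I)) :
  gaussian_family D Y K ->
  (forall j, E j -> measurable_fun setT (Z j)) ->
  (forall j, E j -> \forall n \near \oo, indexed_in D (L n j)) ->
  (forall j, E j ->
     {ae P, forall x, (fun n => comb (L n j) Y x) @ \oo --> Z j x}) ->
  (forall i j, E i -> E j ->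
     (fun n => quad K (L n i) (L n j)) @ \oo --> K' i j) ->
  gaussian_family E Z K'.
Proof.
move=> [sK gY] mZ DL cZ cK; split.
  move=> i j Ei Ej; have := cK i j Ei Ej; have := cK j i Ej Ei.
  move=> cji cij; apply: cvg_unique cij _ => //.
  apply: cvg_trans cji; apply: near_eq_cvg.
  near=> n; apply: (quad_sym sK).
    by near: n; exact: DL.
  by near: n; exact: DL.
move=> m Em.
apply: (@centered_gaussian_lim _ _ _ _
  (fun n => quad K (comb_bind (L n) m) (comb_bind (L n) m)) _
  (fun n => comb (comb_bind (L n) m) Y)).
- have : \forall n \near \oo, indexed_in D (comb_bind (L n) m).
    elim: m Em => [|p m ih] Em; first by near=> n => p.
    have h1 := DL _ (Em _ (mem_head _ _)).
    have h2 : \forall n \near \oo, indexed_in D (comb_bind (L n) m).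
      by apply: ih => q qm; apply: Em; rewrite in_cons qm orbT.
    apply: filterS2 h1 h2 => n h1 h2 q.
    rewrite /comb_bind /= mem_cat => /orP[/mapP[q' q'L ->] /=|]; last exact: h2.
    exact: h1.
  by apply: filterS => n; exact: gY.
- under eq_fun do rewrite quad_bindE.
  apply: cvg_sum_seq => p pm; apply: cvg_sum_seq => q qm.
  by apply: cvgMr; apply: cK; exact: Em.
- by apply: measurable_comb => p pm; apply: mZ; exact: Em.
- elim: m Em => [|p m ih] Em.
    apply: aeW => x; have -> : comb [::] Z x = 0 by rewrite /comb big_nil.
    by apply: cvg_near_cst; apply: nearW => n; rewrite /comb /= big_nil.
  have h1 := cZ _ (Em _ (mem_head _ _)).
  have h2 := ih (fun q qm => Em q (@mem_behead _ (p :: m) q qm)).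
  apply: filterS2 h1 h2 => x h1 h2.
  rewrite (_ : (fun n => _) = (fun n => p.1 * comb (L n p.2) Y x +
      comb (comb_bind (L n) m) Y x)); last first.
    by apply/funext => n; rewrite comb_bindE big_cons -comb_bindE.
  by rewrite [X in _ --> X]big_cons; apply: cvgD => //; exact: cvgMr.
Unshelve. all: by end_near. Qed.

End gaussian_family.

(** * The noise as a Gaussian family *)

Section noise.
Context {R : realType} {dOm : measure_display} {Om : measurableType dOm}.
Variable P : probability Om R.

Lemma integral_comb (I : eqType) (l : seq (R * I)) (f : I -> Om -> R) (m : I -> R) :
  (forall p, p \in l -> P.-integrable setT (EFin \o f p.2) /\
     (\int[P]_x (f p.2 x)%:E = (m p.2)%:E)%E) ->
  P.-integrable setT (EFin \o comb l f) /\
  (\int[P]_x (comb l f x)%:E = (\sum_(p <- l) p.1 * m p.2)%:E)%E.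
Proof.
elim: l => [|p l ih] h.
  have -> : comb [::] f = cst 0 by apply/funext => x; rewrite /comb big_nil.
  split; first exact: finite_measure_integrable_cst.
  by rewrite big_nil integral0.
have [ip Ep] := h p (mem_head _ _).
have [il El] := ih (fun q ql => h q (@mem_behead _ (p :: l) q ql)).
have E : EFin \o comb (p :: l) f =
    (fun x => (p.1%:E * (f p.2 x)%:E) + (comb l f x)%:E)%E.
  by apply/funext => x /=; rewrite /comb big_cons.
have i1 : P.-integrable setT (fun x => p.1%:E * (f p.2 x)%:E)%E by exact: integrableZl.
split; first by rewrite E; exact: integrableD.
have -> : (\int[P]_x (comb (p :: l) f x)%:E =
  \int[P]_x ((p.1%:E * (f p.2 x)%:E) + (comb l f x)%:E))%E.
  by apply: eq_integral => x _; have /(congr1 (@^~ x)) := E.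
rewrite integralD// integralZl// El big_cons.
by move: Ep => /= ->; rewrite -EFinM -EFinD.
Qed.

Lemma sqr_comb (I : Type) (l : seq (R * I)) (Y : I -> Om -> R) x :
  comb l Y x ^+ 2 = comb [seq (p.1 * q.1, (p.2, q.2)) | p <- l, q <- l]
    (fun (ij : I * I) x => Y ij.1 x * Y ij.2 x) x.
Proof.
rewrite /comb big_allpairs_dep expr2 mulr_suml; apply: eq_bigr => p _.
by rewrite mulr_sumr; apply: eq_bigr => q _ /=; rewrite mulrACA.
Qed.

Section noise_family.
Variables (d : nat) (D : set R) (w : R -> Om -> 'cV[R]_d) (kappa : R -> 'M[R]_d).
Hypothesis gw : gaussian_process P D w.
Hypothesis w0 : forall t, D t -> has_mean P (w t) 0.
Hypothesis wK : has_autocovariance P D w kappa.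

Definition noise (p : R * 'I_d) (om : Om) : R := w p.1 om p.2 0.
Definition noise_cov (p q : R * 'I_d) : R := kappa (q.1 - p.1) p.2 q.2.
Definition noise_index : set (R * 'I_d) := [set p | D p.1].

Lemma noise_gaussian l : indexed_in noise_index l -> gaussian_rv P (comb l noise).
Proof.
move=> Dl; pose e k := tnth (in_tuple l) k.
have := @gw (size l) (fun k => (e k).2.1) (fun k => (e k).1 *: delta_mx 0 (e k).2.2).
have E : (fun om => \sum_(k < size l)
    ((e k).1 *: (delta_mx 0 (e k).2.2 : 'rV_d) *m w (e k).2.1 om) 0 0) =1 comb l noise.
  move=> om; rewrite /comb [RHS]big_tnth; apply: eq_bigr => k _.
  by rewrite -scalemxAl mxE -rowE mxE.
rewrite (funext E).
by apply=> k; exact: (Dl _ (mem_tnth k (in_tuple l))).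
Qed.

Lemma measurable_noise p : noise_index p -> measurable_fun setT (noise p).
Proof.
move=> Dp; have /noise_gaussian[+ _] : indexed_in noise_index [:: (1 : R, p)].
  by move=> q; rewrite inE => /eqP ->.
by rewrite /comb; under eq_fun do rewrite big_seq1 mul1r.
Qed.

(** The autocovariance at lag 0 is a finite second moment. *)
Lemma noise_sqr_integrable p : noise_index p ->
  P.-integrable setT (fun x => (noise p x ^+ 2)%:E).
Proof.
move=> Dp; apply/integrableP; split.
  by apply/measurable_EFinP; apply: measurable_funX; exact: measurable_noise.
under eq_integral do rewrite gee0_abs ?lee_fin ?sqr_ge0//.
have := @wK p.1 0 Dp; rewrite addr0 => /(_ Dp p.2 p.2); rewrite unlock.
move=> h; rewrite [X in (X < _)%E](_ : _ = (kappa 0 p.2 p.2)%:E) ?ltry//.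
Qed.

Lemma noise_cov_integral p q : noise_index p -> noise_index q ->
  P.-integrable setT (EFin \o (fun x => noise p x * noise q x)) /\
  (\int[P]_x (noise p x * noise q x)%:E = (noise_cov p q)%:E)%E.
Proof.
move=> Dp Dq; split.
  have i : P.-integrable setT (fun x => (noise p x ^+ 2)%:E + (noise q x ^+ 2)%:E)%E.
    by apply: integrableD => //; exact: noise_sqr_integrable.
  apply: le_integrable i => //.
    apply/measurable_EFinP; apply: measurable_funM; exact: measurable_noise.
  move=> x _ /=; rewrite lee_fin [leRHS]ger0_norm ?addr_ge0 ?sqr_ge0//.
  rewrite normrM -[noise p x ^+ 2]real_normK ?num_real//.
  rewrite -[noise q x ^+ 2]real_normK ?num_real//.
  have := sqr_ge0 (`|noise p x| - `|noise q x|).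
  by have := normr_ge0 (noise p x); have := normr_ge0 (noise q x); nra.
have e : p.1 + (q.1 - p.1) = q.1 by rewrite addrC subrK.
have := @wK p.1 (q.1 - p.1) Dp; rewrite e => /(_ Dq p.2 q.2); rewrite unlock.
exact.
Qed.

Lemma noise_mean p : noise_index p ->
  P.-integrable setT (EFin \o noise p) /\ (\int[P]_x (noise p x)%:E = 0%:E)%E.
Proof.
move=> Dp; split; last first.
  by have := @w0 p.1 Dp p.2; rewrite mxE unlock.
have i : P.-integrable setT (fun x => (noise p x ^+ 2)%:E + 1%:E)%E.
  apply: integrableD => //; first exact: noise_sqr_integrable.
  exact: finite_measure_integrable_cst.
apply: le_integrable i => //.
  by apply/measurable_EFinP; exact: measurable_noise.
move=> x _ /=; rewrite lee_fin [leRHS]ger0_norm ?addr_ge0 ?sqr_ge0//.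
rewrite -[noise p x ^+ 2]real_normK ?num_real//.
by have := sqr_ge0 (`|noise p x| - 1); have := normr_ge0 (noise p x); nra.
Qed.

Lemma noise_family : gaussian_family P noise_index noise noise_cov.
Proof.
split=> [p q Dp Dq|l Dl].
  apply: EFin_inj; rewrite -(noise_cov_integral Dp Dq).2 -(noise_cov_integral Dq Dp).2.
  by apply: eq_integral => x _; rewrite mulrC.
apply: gaussian_rv_centered; first exact: noise_gaussian.
  have [p pl|_ ->] := @integral_comb _ l noise (fun=> 0).
    exact: noise_mean (Dl p pl).
  by rewrite big1// => p _; rewrite mulr0.
under eq_integral do rewrite sqr_comb.
have [p /allpairsP[[q r] /= [ql rl ->]]|_ ->] := @integral_comb _
  [seq (p.1 * q.1, (p.2, q.2)) | p <- l, q <- l]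
  (fun ij x => noise ij.1 x * noise ij.2 x) (fun ij => noise_cov ij.1 ij.2).
  exact: noise_cov_integral (Dl _ ql) (Dl _ rl).
by rewrite big_allpairs_dep.
Qed.

End noise_family.
End noise.

(** * Power series and finite differences at the origin *)

Section power_series.
Context {R : realType}.

(** A Cauchy estimate: [a n] is O(r^(-n)).  Unlike convergence at [r], it can be
    tested term by term. *)
Definition gbounded (r : R) (a : nat -> R) : Prop :=
  exists C, forall n, `|a n| * r ^+ n <= C.

Lemma pseries_gbounded r a : 0 <= r -> cvgn (pseries a r) -> gbounded r a.
Proof.
move=> r0 /cvg_series_bounded [M [_ hM]].
exists (M + 1) => n.
have M1 : M < M + 1 by rewrite ltrDl.
have /= := hM (M + 1) M1 n Logic.I.
by rewrite normrM normrX (ger0_norm r0).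
Qed.

Lemma geometric_sum_le (q : R) n : 0 <= q < 1 ->
  \sum_(0 <= i < n) q ^+ i <= (1 - q)^-1.
Proof.
move=> /andP[q0 q1]; have q1' : 0 < 1 - q by rewrite subr_gt0.
rewrite -[leRHS]mul1r ler_pdivlMr// big_mkord mulrC -opprB mulNr -subrX1.
by rewrite opprB gerBl exprn_ge0.
Qed.

Lemma gbounded_cvg r t a : 0 < r -> gbounded r a -> `|t| < r ->
  cvgn (pseries a t).
Proof.
move=> r0 [C hC] tr; apply: normed_cvg.
pose q := `|t| / r.
have q01 : `|q| < 1.
  by rewrite ger0_norm ?divr_ge0 ?(ltW r0)// ltr_pdivrMr// mul1r.
apply: (@series_le_cvg _ _ (geometric C q)) => //.
- by move=> n /=.
- move=> n; rewrite /geometric/= mulr_ge0 ?exprn_ge0 ?divr_ge0 ?(ltW r0)//.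
  by rewrite (le_trans _ (hC 0))// mulr_ge0.
- move=> n; rewrite /geometric/= normrM normrX expr_div_n mulrA ler_pdivlMr ?exprn_gt0//.
  by rewrite mulrAC ler_wpM2r ?exprn_ge0.
- exact: is_cvg_geometric_series.
Qed.

Lemma pseries_tail (r t : R) (a : nat -> R) (C s : R) (N : nat) :
  0 < r -> (forall n, `|a n| * r ^+ n <= C) ->
  `|t| <= r / 2 -> pseries a t @ \oo --> s ->
  `|s - \sum_(0 <= i < N) a i * t ^+ i| <= 2 * C * (`|t| / r) ^+ N.
Proof.
move=> r0 hC tr cs.
have q0 : 0 <= `|t| / r by rewrite divr_ge0 ?(ltW r0).
have q1 : `|t| / r <= 2^-1 by rewrite ler_pdivrMr// mulrC.
have C0 : 0 <= C by rewrite (le_trans _ (hC 0))// mulr_ge0.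
have cs' : (fun n => `|pseries a t n - \sum_(0 <= i < N) a i * t ^+ i|) @ \oo -->
   `|s - \sum_(0 <= i < N) a i * t ^+ i|.
  by apply: cvg_norm; apply: cvgB => //; exact: cvg_cst.
rewrite -(cvg_lim _ cs')//; apply: limr_le; first by apply/cvg_ex; eexists; exact: cs'.
near=> M.
have NM : (N <= M)%N by near: M; exact: nbhs_infty_ge.
rewrite /pseries /series/= (big_cat_nat (n := N))//= addrAC subrr add0r.
rewrite (le_trans (ler_norm_sum _ _ _))//.
apply: (@le_trans _ _ (\sum_(N <= i < M) C * (`|t| / r) ^+ i)).
  apply: ler_sum => i _; rewrite normrM normrX expr_div_n mulrA.
  by rewrite ler_pdivlMr ?exprn_gt0// mulrAC ler_wpM2r ?exprn_ge0.
rewrite -mulr_sumr (mulrC 2) -mulrA ler_wpM2l//.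
rewrite -{1}[N]add0n big_addn.
under eq_bigr do rewrite exprD.
rewrite -mulr_suml ler_wpM2r ?exprn_ge0//.
apply: le_trans (geometric_sum_le _ _) _.
  by rewrite q0/= (le_lt_trans q1)// invf_lt1// ltr1n.
rewrite invf_ple ?posrE// ?subr_gt0; last 1 first.
  by rewrite (le_lt_trans q1)// invf_lt1// ltr1n.
by lra.
Unshelve. all: by end_near. Qed.

End power_series.

Section finite_differences.
Context {R : realType}.

(** A list of pairs (weight, node) stands for the linear functional that sums
    weight * f(node); this is its value on the monomial of degree [p]. *)
Definition moment (l : seq (R * R)) (p : nat) : R := \sum_(q <- l) q.1 * q.2 ^+ p.

(** The [n]-th forward difference with unit step. *)
Fixpoint fdiff (n : nat) : seq (R * R) :=
  if n is n'.+1 then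
    [seq (q.1, q.2 + 1) | q <- fdiff n'] ++ [seq (- q.1, q.2) | q <- fdiff n']
  else [:: (1, 0)].

Lemma moment_fdiffS n p :
  moment (fdiff n.+1) p = \sum_(i < p) moment (fdiff n) i *+ 'C(p, i).
Proof.
rewrite /moment /= big_cat !big_map /= -big_split /=.
under eq_bigr => q _.
  rewrite mulNr (addrC q.2) exprDn big_ord_recr/= subnn expr0 mul1r binn mulr1n.
  rewrite mulrDr addrK mulr_sumr.
  over.
rewrite exchange_big/=; apply: eq_bigr => i _.
rewrite -sumrMnl; apply: eq_bigr => q _.
by rewrite expr1n mul1r mulrnAr.
Qed.

(** Each differencing lowers the degree by one and multiplies the leading
    coefficient by the degree. *)
Lemma moment_fdiff n p : (p <= n)%N ->
  moment (fdiff n) p = if p == n then n`!%:R else 0.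
Proof.
elim: n p => [|n ih] p pn.
  by move: pn; rewrite leqn0 => /eqP ->; rewrite /moment big_seq1 expr0 mulr1.
rewrite moment_fdiffS; move: pn; rewrite leq_eqVlt => /orP[/eqP ->|pn].
  rewrite eqxx big_ord_recr/= ih// eqxx big1 ?add0r => [|i _].
    by rewrite binSn -mulrnA mulnC -factS.
  by rewrite ih 1?ltnW// ltn_eqF// mul0rn.
rewrite ltn_eqF// big1// => i _.
have ip : (i < n)%N by rewrite (leq_trans (ltn_ord i)).
by rewrite ih 1?ltnW// ltn_eqF// mul0rn.
Qed.

(** The functional obtained by applying [l] in [s] and [l'] in [t] to a function
    of [t - s]; an autocovariance is such a function. *)
Definition cross_diff (l l' : seq (R * R)) : seq (R * R) :=
  [seq (p.1 * q.1, q.2 - p.2) | p <- l, q <- l'].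

Lemma moment_cross_diff l l' p :
  moment (cross_diff l l') p =
  \sum_(i < p.+1) (-1) ^+ i * (moment l i * moment l' (p - i)) *+ 'C(p, i).
Proof.
rewrite /moment big_allpairs_dep/=.
under eq_bigr => u _.
  under eq_bigr => v _.
    rewrite exprBn mulr_sumr; over.
  rewrite exchange_big; over.
rewrite exchange_big/=; apply: eq_bigr => i _.
rewrite mulr_suml mulr_sumr -sumrMnl; apply: eq_bigr => u _.
rewrite mulr_sumr mulr_sumr -sumrMnl; apply: eq_bigr => v _.
rewrite mulrnAr; congr (_ *+ _); ring.
Qed.

(** In the binomial expansion of (t - s)^p only the product of the moments of
    orders [m] and [n] can survive. *)
Lemma moment_cross_fdiff m n p : (p <= m + n)%N ->
  moment (cross_diff (fdiff m) (fdiff n)) p =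
  if (p == m + n)%N then (-1) ^+ m * (m + n)`!%:R else 0.
Proof.
move=> pmn; rewrite moment_cross_diff.
have Z (i : 'I_p.+1) : (i != m :> nat) || (p != m + n)%N ->
    moment (fdiff m) i * moment (fdiff n) (p - i) = 0.
  move=> h; have [im|im|im] := ltngtP i m.
  - by rewrite moment_fdiff 1?ltnW// ltn_eqF// mul0r.
  - have pin : (p - i < n)%N by have := ltn_ord i; lia.
    by rewrite [X in _ * X]moment_fdiff 1?ltnW// ltn_eqF// mulr0.
  - move: h; rewrite im eqxx/= => h.
    have pin : (p - m < n)%N by have := ltn_ord i; rewrite im; lia.
    by rewrite [X in _ * X]moment_fdiff 1?ltnW// ltn_eqF// mulr0.
case: eqVneq => [pE|pE]; last first.
  by rewrite big1// => i _; rewrite Z ?pE ?orbT// mulr0 mul0rn.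
have mp : (m < p.+1)%N by rewrite pE; lia.
rewrite (bigD1 (Ordinal mp))//= big1 ?addr0; last first.
  by move=> i im; rewrite Z ?im// mulr0 mul0rn.
rewrite pE addKn !moment_fdiff// !eqxx -mulrnAr; congr (_ * _).
rewrite -(bin_fact (leq_addr n m)) addKn !natrM -mulr_natr; ring.
Qed.

Lemma near_all_seq (T : eqType) (l : seq T) (Q : nat -> T -> Prop) :
  (forall x, x \in l -> \forall n \near \oo, Q n x) ->
  \forall n \near \oo, forall x, x \in l -> Q n x.
Proof.
elim: l => [|y l ih] h; first by near=> n.
have h1 := h y (mem_head _ _).
have h2 := ih (fun x xl => h x (@mem_behead _ (y :: l) x xl)).
by apply: filterS2 h1 h2 => n h1 h2 x; rewrite in_cons => /predU1P[->|/h2].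
Unshelve. all: by end_near. Qed.

Lemma near_scaled (h_ : nat -> R) (a e : R) : h_ @ \oo --> 0 -> 0 < e ->
  \forall n \near \oo, `|a * h_ n| <= e.
Proof.
move=> h0 e0; have : (fun n => a * h_ n) @ \oo --> a * 0 by exact: cvgMr.
rewrite mulr0 => /cvgr0Pnorm_le; exact.
Qed.

(** Insert f(t) = sum_(p <= N) c_p t^p + O(t^(N+1)): the terms of degree below
    [N] cancel by hypothesis, the term of degree [N] gives the limit, and the
    remainder contributes O(h). *)
Lemma stencil_cvg (l : seq (R * R)) N (f : R -> R) (c : nat -> R) r0
    (h_ : nat -> R) :
  0 < r0 -> (forall t, `|t| < r0 -> pseries c t @ \oo --> f t) ->
  (forall p, (p < N)%N -> moment l p = 0) ->
  (forall n, h_ n != 0) -> h_ @ \oo --> 0 ->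
  (fun n => h_ n ^- N * \sum_(q <- l) q.1 * f (q.2 * h_ n)) @ \oo -->
  c N * moment l N.
Proof.
move=> r0_gt0 cf mom h_n0 h0.
have [r [r_gt0 rr0]] : exists r : R, 0 < r /\ r < r0 by exists (r0 / 2); split; lra.
have [C hC] : gbounded r c.
  apply: pseries_gbounded; first exact: ltW.
  by apply/cvg_ex; exists (f r); apply: cf; rewrite ger0_norm// ltW.
pose K := \sum_(q <- l) `|q.1| * (2 * C * (`|q.2| / r) ^+ N.+1).
apply/cvgrPdist_le => e e0.
have hK : \forall n \near \oo, `|K * h_ n| <= e by exact: near_scaled.
have hl : \forall n \near \oo, forall q, q \in l -> `|q.2 * h_ n| <= r / 2.
  by apply: near_all_seq => q _; apply: near_scaled => //; rewrite divr_gt0.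
apply: filterS2 hK hl => n hK hl.
have hn := h_n0 n; set h := h_ n in hK hl hn *.
pose T (t : R) := \sum_(0 <= i < N.+1) c i * t ^+ i.
have ET : \sum_(q <- l) q.1 * T (q.2 * h) = h ^+ N * (c N * moment l N).
  rewrite /T; under eq_bigr do rewrite mulr_sumr.
  rewrite exchange_big/= big_nat_recr//= big_nat big1 ?add0r.
    rewrite /moment !mulr_sumr; apply: eq_bigr => q _; rewrite exprMn; ring.
  move=> i /andP[_ iN].
  transitivity (c i * h ^+ i * moment l i); last by rewrite mom// mulr0.
  rewrite /moment mulr_sumr; apply: eq_bigr => q _; rewrite exprMn; ring.
have -> : c N * moment l N - h ^- N * \sum_(q <- l) q.1 * f (q.2 * h) =
   - (h ^- N * \sum_(q <- l) q.1 * (f (q.2 * h) - T (q.2 * h))).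
  under [X in _ = - (_ * X)]eq_bigr do rewrite mulrBr.
  rewrite sumrB ET mulrBr mulKf ?expf_neq0//; ring.
rewrite normrN; apply: le_trans hK.
rewrite normrM normfV normrX mulrC ler_pdivrMr ?exprn_gt0 ?normr_gt0//.
apply: le_trans (ler_norm_sum _ _ _) _.
rewrite normrM /K [X in X * _ * _]ger0_norm; last first.
  apply: sumr_ge0 => q _; rewrite !mulr_ge0// ?exprn_ge0 ?divr_ge0 ?(ltW r_gt0)//.
  by rewrite (le_trans _ (hC 0))// mulr_ge0.
rewrite -mulrA -exprS mulr_suml big_seq [leRHS]big_seq; apply: ler_sum => q ql.
rewrite normrM -[leRHS]mulrA ler_wpM2l//.
apply: le_trans (@pseries_tail _ r _ c C _ N.+1 _ hC _ _) _ => //.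
- exact: hl.
- apply: cf; apply: le_lt_trans (hl _ ql) _; lra.
- by rewrite normrM (mulrAC `|q.2|) exprMn mulrA.
Qed.

End finite_differences.

(** * The derivatives of the noise at time 0 *)

Section derivative_family.
Context {R : realType} {dOm : measure_display} {Om : measurableType dOm}.
Variable P : probability Om R.
Variables (d : nat) (D : set R) (w : R -> Om -> 'cV[R]_d) (kappa : R -> 'M[R]_d).

Lemma measurable_lim_near (f_ : nat -> Om -> R) (f : Om -> R) :
  (\forall n \near \oo, measurable_fun setT (f_ n)) ->
  (forall om, f_ ^~ om @ \oo --> f om) -> measurable_fun setT f.
Proof.
move=> [N _ mf] cf.
apply: (@measurable_fun_cvg _ _ _ setT (fun n => f_ (n + N)%N)) => //.
  by move=> n; apply: mf => /=; exact: leq_addl.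
by move=> om _; rewrite (cvg_shiftn N (f_ ^~ om)).
Qed.

(** Set to 0 outside the measurable event [A] of analytic paths, which makes it
    a measurable function on the whole sample space. *)
Definition noise_deriv (A : set Om) (p : nat * 'I_d) (om : Om) : R :=
  if om \in A then ((w ^~ om)^`(p.1))%classic 0 p.2 0 else 0.

(** The kernel E[W_k W_l^T], obtained by differentiating kappa(t - s) at the
    origin k times in s and l times in t. *)
Definition deriv_cov (p q : nat * 'I_d) : R :=
  (-1) ^+ p.1 * (kappa^`(p.1 + q.1))%classic 0 p.2 q.2.

Variable A : set Om.
Hypothesis mA : measurable A.
Hypothesis A1 : P (~` A) = 0%E.
Hypothesis D0 : exists2 e : R, 0 < e & forall t, `|t| <= e -> D t.
Hypothesis kappa_series : exists2 r : R, 0 < r & forall t, `|t| < r -> forall i j,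
  pseries (fun n => (kappa^`(n))%classic 0 i j / n`!%:R) t @ \oo --> kappa t i j.
Hypothesis noise_series : forall om, A om -> exists2 r : R, 0 < r &
  forall t, `|t| < r -> forall i,
  pseries (fun n => ((w ^~ om)^`(n))%classic 0 i 0 / n`!%:R) t @ \oo --> w t om i 0.
Hypothesis gw : gaussian_family P (noise_index D) (noise w) (noise_cov kappa).

Let h (n : nat) : R := n.+1%:R^-1.

Let h_neq0 n : h n != 0. Proof. by rewrite invr_neq0. Qed.

Let h_cvg0 : h @ \oo --> 0. Proof. exact: cvg_harmonic. Qed.

(* the difference quotient of order [p.1] of the coordinate [p.2] of the noise *)
Let L (n : nat) (p : nat * 'I_d) : seq (R * (R * 'I_d)) :=
  [seq (h n ^- p.1 * q.1, (q.2 * h n, p.2)) | q <- fdiff p.1].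

Let L_noise n p om : comb (L n p) (noise w) om =
  h n ^- p.1 * \sum_(q <- fdiff p.1) q.1 * w (q.2 * h n) om p.2 0.
Proof.
by rewrite /comb big_map mulr_sumr; apply: eq_bigr => q _ /=; rewrite mulrA.
Qed.

Let L_cov n p q : quad (noise_cov kappa) (L n p) (L n q) =
  h n ^- (p.1 + q.1) * \sum_(u <- cross_diff (fdiff p.1) (fdiff q.1))
    u.1 * kappa (u.2 * h n) p.2 q.2.
Proof.
rewrite /quad big_map big_allpairs_dep mulr_sumr; apply: eq_bigr => u _.
rewrite big_map mulr_sumr; apply: eq_bigr => v _ /=.
rewrite /noise_cov/= mulrBl exprD invfM; ring.
Qed.

Let L_index p : \forall n \near \oo, indexed_in (noise_index D) (L n p).
Proof.
have [e e0 eD] := D0.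
have : \forall n \near \oo, forall q, q \in fdiff p.1 -> `|q.2 * h n| <= e.
  by apply: near_all_seq => q _; exact: near_scaled.
apply: filterS => n hn u /mapP[q ql ->] /=; rewrite /noise_index/=.
by apply: eD; exact: hn.
Qed.

Let fact_neq0 n : n`!%:R != 0 :> R.
Proof. by rewrite pnatr_eq0 -lt0n fact_gt0. Qed.

Let L_cvg p om : A om ->
  (fun n => comb (L n p) (noise w) om) @ \oo --> noise_deriv A p om.
Proof.
move=> Aom; have [r r0 hr] := noise_series Aom.
rewrite /noise_deriv mem_set//.
under eq_fun do rewrite L_noise.
have := @stencil_cvg R (fdiff p.1) p.1 (fun t => w t om p.2 0)
  (fun n => ((w ^~ om)^`(n))%classic 0 p.2 0 / n`!%:R) r h r0.
rewrite moment_fdiff// eqxx divfK//; apply=> //.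
- by move=> t tr; exact: hr.
- by move=> k kp; rewrite moment_fdiff 1?ltnW// ltn_eqF.
Qed.

Let ae_A : {ae P, forall om, A om}.
Proof. by exists (~` A); split => //; exact: measurableC. Qed.

Lemma measurable_noise_deriv p : measurable_fun setT (noise_deriv A p).
Proof.
apply: (@measurable_lim_near (fun n om => comb (L n p) (noise w) om * \1_A om)).
  apply: filterS (L_index p) => n nL; apply: measurable_funM.
    by have [_ /(_ _ nL)[]] := gw.
  exact: measurable_indic.
move=> om; have [Aom|Aom] := pselect (A om).
  rewrite indicE mem_set// mulr1n; under eq_fun do rewrite mulr1.
  exact: L_cvg.
rewrite indicE memNset// /noise_deriv memNset//.
under eq_fun do rewrite mulr0; exact: cvg_cst.
Qed.

(** Both convergences required by [gaussian_family_lim] are instances of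
    [stencil_cvg]: along the paths for a single difference, and along [kappa]
    for the product of two differences, where
    E[w_s w_t^T] = kappa(t - s) produces the sign. *)
Lemma noise_deriv_family :
  gaussian_family P setT (noise_deriv A) deriv_cov.
Proof.
apply: (gaussian_family_lim (L := L) gw).
- by move=> p _; exact: measurable_noise_deriv.
- by move=> p _; exact: L_index.
- by move=> p _; apply: filterS ae_A => om; exact: L_cvg.
- move=> p q _ _; have [r r0 hr] := kappa_series.
  under eq_fun do rewrite L_cov.
  have := @stencil_cvg R (cross_diff (fdiff p.1) (fdiff q.1)) (p.1 + q.1)
    (fun t => kappa t p.2 q.2)
    (fun n => (kappa^`(n))%classic 0 p.2 q.2 / n`!%:R) r h r0.
  rewrite moment_cross_fdiff// eqxx mulrCA divfK//; apply=> //.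
  + by move=> t tr; exact: hr.
  + by move=> k kp; rewrite moment_cross_fdiff 1?ltnW// ltn_eqF.
Qed.

End derivative_family.

(** * The radius of convergence of the paths of the noise *)

Section radius.
Context {R : realType} {dOm : measure_display} {Om : measurableType dOm}.
Variable P : probability Om R.

(** The sum of the squares has a finite expectation, hence is almost surely
    finite. *)
Lemma ae_bounded_of_sqr_summable (f : nat -> Om -> R) (K q : R) :
  0 <= q < 1 -> (forall n, measurable_fun setT (f n)) ->
  (forall n, (\int[P]_x (f n x ^+ 2)%:E <= (K * q ^+ n)%:E)%E) ->
  {ae P, forall x, exists C, forall n, `|f n x| <= C}.
Proof.
move=> q01 mf fK.
have K0 : 0 <= K.
  have := fK 0%N; rewrite expr0 mulr1 -lee_fin; apply: le_trans.
  by apply: integral_ge0 => x _; rewrite lee_fin sqr_ge0.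
have mf2 n : measurable_fun setT (fun x => (f n x ^+ 2)%:E).
  by apply/measurable_EFinP; exact: measurable_funX.
pose g x := (\sum_(0 <= n <oo) (f n x ^+ 2)%:E)%E.
have mg : measurable_fun setT g.
  by apply: ge0_emeasurable_sum => // n x _ _; rewrite lee_fin sqr_ge0.
have ig : P.-integrable setT g.
  apply/integrableP; split => //.
  have -> : (\int[P]_x `|g x| = \int[P]_x g x)%E.
    apply: eq_integral => x _; rewrite gee0_abs//.
    by apply: nneseries_ge0 => n _ _; rewrite lee_fin sqr_ge0.
  rewrite integral_nneseries//; last by move=> n x _; rewrite lee_fin sqr_ge0.
  apply: (@le_lt_trans _ _ (K * (1 - q)^-1)%:E); last exact: ltry.
  apply: lime_le.
    by apply: is_cvg_nneseries => n _ _; apply: integral_ge0 => x _; rewrite lee_fin sqr_ge0.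
  apply: nearW => M.
  apply: (@le_trans _ _ (\sum_(0 <= n < M) (K * q ^+ n)%:E)%E).
    by apply: lee_sum => n _; exact: fK.
  by rewrite sumEFin lee_fin -mulr_sumr ler_wpM2l// geometric_sum_le.
apply: filterS (integrable_ae measurableT ig) => x /(_ Logic.I) gx.
exists (fine (g x) + 1) => n.
have : ((f n x ^+ 2)%:E <= g x)%E.
  apply: le_trans (nneseries_lim_ge n.+1 _); last first.
    by move=> k _ _; rewrite lee_fin sqr_ge0.
  rewrite big_nat_recr//= leeDr//.
  by apply: sume_ge0 => k _; rewrite lee_fin sqr_ge0.
rewrite -(fineK gx) lee_fin -[f n x ^+ 2]real_normK ?num_real//.
by have := normr_ge0 (f n x); have := sqr_ge0 (`|f n x| - 1); nra.
Qed.

Lemma bin_leq_exp2 n k : ('C(n, k) <= 2 ^ n)%N.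
Proof.
have [kn|nk] := leqP k n; last by rewrite bin_small.
have := expnDn 1 1 n; rewrite addn1 => ->.
rewrite (bigD1 (Ordinal (kn : (k < n.+1)%N)))//= !exp1n !muln1.
exact: leq_addr.
Qed.

Lemma gbounded_le (r r' : R) a : 0 <= r -> r <= r' -> gbounded r' a -> gbounded r a.
Proof.
move=> r0 rr' [C hC]; exists C => n; apply: le_trans (hC n).
by rewrite ler_wpM2l// lerXn2r// nnegrE// (le_trans r0).
Qed.

Variables (d : nat) (kappa : R -> 'M[R]_d) (W : nat * 'I_d -> Om -> R).
Hypothesis gW : gaussian_family P setT W (deriv_cov kappa).
Variable D : set R.
Hypothesis D_open : forall t, D t -> exists2 t' : R, `|t| < t' & D t'.
Hypothesis D_ball : forall s t, `|s| <= `|t| -> D t -> D s.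
Hypothesis kappa_bound : forall q, D q -> 0 < q -> exists K, forall n i j,
  `|(kappa^`(n))%classic 0 i j / n`!%:R| * (2 * q) ^+ n <= K.

(** The second moment of W_n is the modulus of a diagonal entry of
    kappa^(2n)(0), which is at most
    K (2n)! / (2q')^(2n) <= K (n! / q'^n)^2 for some [q' > q]. *)
Lemma ae_gbounded1 q i : D q -> 0 < q ->
  {ae P, forall om, gbounded q (fun n => W (n, i) om / n`!%:R)}.
Proof.
move=> Dq q0; have [q' qq' Dq'] := D_open Dq.
rewrite (ger0_norm (ltW q0)) in qq'.
have q'0 : 0 < q' := lt_trans q0 qq'.
have [K hK] := kappa_bound Dq' q'0.
have mW n : measurable_fun setT (W (n, i)) by have [] := gaussian_family1 gW (i := (n, i)) Logic.I.
have [] := @ae_bounded_of_sqr_summable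
  (fun n om => W (n, i) om / n`!%:R * q ^+ n) K ((q / q') ^+ 2).
- rewrite exprn_ge0 ?divr_ge0 ?ltW//= exprn_ilt1 ?divr_ge0 ?ltW//.
  by rewrite ltr_pdivrMr ?mul1r.
- by move=> n; apply: measurable_funM => //; exact: measurable_funM.
- move=> n; have g1 := gaussian_family1 gW (i := (n, i)) Logic.I.
  pose c : R := (n`!%:R^-1 * q ^+ n) ^+ 2.
  have -> : (\int[P]_x ((W (n, i) x / n`!%:R * q ^+ n) ^+ 2)%:E =
      \int[P]_x (c%:E * (W (n, i) x ^+ 2)%:E))%E.
    apply: eq_integral => x _; rewrite -EFinM; congr EFin; rewrite /c; ring.
  rewrite integralZl//; last exact: centered_gaussian_sqr_integrable g1.
  rewrite (centered_gaussian_variance g1) -EFinM lee_fin /deriv_cov/=.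
  apply: le_trans (ler_norm _) _.
  rewrite normrM (ger0_norm (sqr_ge0 _)) normrM normrX normrN1 expr1n mul1r.
  have := hK (n + n)%N i i.
  set k := (kappa^`(n + n))%classic 0 i i.
  have f0 m : (0 : R) < m`!%:R by rewrite ltr0n fact_gt0.
  rewrite normrM normfV (ger0_norm (ler0n R _)) => hk.
  have cb : (n + n)`!%:R <= n`!%:R ^+ 2 * 4 ^+ n :> R.
    rewrite -natrX -natrX -natrM ler_nat.
    rewrite -(bin_fact (leq_addl n n)) addnK -mulnn mulnC leq_mul2l.
    by rewrite -(@expnM 2 2) mul2n -addnn bin_leq_exp2 orbT.
  have X0 : 0 < q' ^+ n by rewrite exprn_gt0.
  have fn0 := f0 n; have fnn0 := f0 (n + n)%N.
  have p4 : (0 : R) < 4 ^+ n by rewrite exprn_gt0.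
  have K0 : 0 <= K.
    by apply: le_trans hk; rewrite mulr_ge0 ?divr_ge0 ?exprn_ge0 ?mulr_ge0 ?(ltW q'0).
  have e4 : (2 * q') ^+ (n + n) = 4 ^+ n * (q' ^+ n) ^+ 2.
    have -> : (4 : R) = 2 * 2 by ring.
    rewrite !exprMn !exprD; ring.
  have hk' : `|k| * (q' ^+ n) ^+ 2 <= K * n`!%:R ^+ 2.
    rewrite -(ler_pM2r p4); apply: (@le_trans _ _ (K * (n + n)`!%:R)).
      by rewrite -ler_pdivrMr//; move: hk; rewrite e4; congr (_ <= _); ring.
    by rewrite -mulrA ler_wpM2l.
  have -> : K * ((q / q') ^+ 2) ^+ n = K * (q ^+ n) ^+ 2 / (q' ^+ n) ^+ 2.
    by rewrite -exprM mulnC exprM expr_div_n expr_div_n mulrA.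
  rewrite ler_pdivlMr ?exprn_gt0//.
  rewrite -mulrA.
  apply: le_trans (ler_wpM2l (sqr_ge0 _) hk') _.
  rewrite le_eqVlt; apply/orP; left; apply/eqP; field.
  by rewrite gt_eqF.
move=> N [mN N0 sN]; exists N; split => // om /= h; apply: sN => /= -[C hC].
apply: h; exists C => n; apply: le_trans (hC n).
by rewrite [leRHS]normrM normrX (ger0_norm (ltW q0)).
Qed.

(** Countably many [q] suffice, since the estimate for one [q] implies it for
    all smaller ones. *)
Lemma ae_gbounded : {ae P, forall om, forall q, D q -> 0 < q -> forall i,
  gbounded q (fun n => W (n, i) om / n`!%:R)}.
Proof.
have : {ae P, forall om : Om, forall (m : nat), forall i : 'I_d,
    let q := ratr (odflt (0 : rat) (@choice.unpickle rat m)) in D q -> 0 < q ->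
    gbounded q (fun n => W (n, i) om / n`!%:R)}.
  apply: ae_foralln => m; set q := ratr _.
  have [Dq|Dq] := pselect (D q); last by apply: aeW => om i /= /Dq.
  have [q0|q0] := ltP 0 q; last by apply: aeW => om i /=; rewrite ltNge q0.
  have : \forall om \ae P, forall i, gbounded q (fun n => W (n, i) om / n`!%:R).
    by apply: filter_forall => i; exact: ae_gbounded1.
  by apply: filterS => om h i /= _ _; exact: h.
apply: filterS => om h q Dq q0 i.
have [q' qq' Dq'] := D_open Dq.
rewrite (ger0_norm (ltW q0)) in qq'.
have [r /[!in_itv]/= /andP[qr rq']] := rat_in_itvoo qq'.
have r0 : 0 < ratr r :> R := lt_trans q0 qr.
apply: gbounded_le (ltW q0) (ltW qr) _.
have := h (choice.pickle r) i; rewrite choice.pickleK/=; apply => //.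
by apply: D_ball Dq'; rewrite !ger0_norm ?ltW// (lt_trans q0).
Qed.

End radius.

(** * Domination of the covariance series *)

Section majorant.
Context {R : realType}.

(** The size of the coefficient of t^(n+1) in the response when A has norm
    [alpha] and W_k is k! q^(-k). *)
Definition duhamel_majorant (alpha q : R) (n : nat) : R :=
  n.+1`!%:R^-1 * \sum_(0 <= k < n.+1) alpha ^+ (n - k) * (k`!%:R * q ^- k).

Lemma fact_gt0R n : 0 < n`!%:R :> R.
Proof. by rewrite ltr0n fact_gt0. Qed.

Lemma exp_terms_bounded (x : R) : 0 <= x ->
  exists E, forall j, x ^+ j / j`!%:R <= E.
Proof.
move=> x0; have [] := @pseries_gbounded R x (fun n => n`!%:R^-1) x0.
  have -> : pseries (fun n => n`!%:R^-1) x = series (exp_coeff x).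
    by apply/funext => n; apply: eq_bigr => i _; rewrite /exp_coeff/= mulrC.
  exact: is_cvg_series_exp_coeff.
move=> E hE; exists E => j; rewrite mulrC; apply: le_trans (hE j).
by rewrite ger0_norm// invr_ge0 ler0n.
Qed.

(** From k! (n-k)! <= (n+1)!, the k-th term is at most
    alpha^(n-k) / (n-k)! q^(-k), and alpha^j / j! is O(s^(-j)) for every [s]
    because the exponential series converges.  What remains is a geometric
    sum of ratio s / q. *)
Lemma duhamel_majorant_bound (alpha s q : R) : 0 <= alpha -> 0 < s -> s < q ->
  exists K, forall n, duhamel_majorant alpha q n * s ^+ n <= K.
Proof.
move=> a0 s0 sq; have q0 : 0 < q := lt_trans s0 sq.
have [E hE] := exp_terms_bounded (mulr_ge0 a0 (ltW s0)).
have E0 : 0 <= E.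
  by apply: le_trans (hE 0%N); rewrite fact0 divr1 expr0.
have sq01 : 0 <= s / q < 1 by rewrite divr_ge0 ?(ltW s0) ?(ltW q0)//= ltr_pdivrMr// mul1r.
exists (E * (1 - s / q)^-1) => n.
apply: le_trans (ler_wpM2l E0 (geometric_sum_le n.+1 sq01)).
rewrite /duhamel_majorant mulrC mulrA !mulr_sumr big_nat [leRHS]big_nat.
apply: ler_sum => k /andP[_ kn].
have {}kn : (k <= n)%N by [].
apply: le_trans (ler_wpM2r _ (hE (n - k)%N)); last first.
  by rewrite exprn_ge0//; case/andP: sq01.
rewrite expr_div_n exprMn.
have -> : alpha ^+ (n - k) * s ^+ (n - k) / (n - k)`!%:R * (s ^+ k / q ^+ k) =
   alpha ^+ (n - k) * q ^- k * s ^+ n * (n - k)`!%:R^-1.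
  have -> : s ^+ n = s ^+ (n - k) * s ^+ k by rewrite -exprD subnK.
  ring.
have -> : s ^+ n / n.+1`!%:R * (alpha ^+ (n - k) * (k`!%:R * q ^- k)) =
   alpha ^+ (n - k) * q ^- k * s ^+ n * (k`!%:R / n.+1`!%:R) by ring.
apply: ler_wpM2l.
  by rewrite !mulr_ge0 ?exprn_ge0 ?invr_ge0 ?exprn_ge0 ?(ltW s0) ?(ltW q0).
rewrite ler_pdivrMr ?fact_gt0R// mulrC ler_pdivlMr ?fact_gt0R//.
rewrite -natrM ler_nat; apply: leq_trans (_ : n`! <= _)%N; last first.
  by rewrite factS leq_pmull.
rewrite -(bin_fact kn); apply: leq_pmull; by rewrite bin_gt0.
Qed.

Lemma duhamel_majorant_ge0 (alpha q : R) n : 0 <= alpha -> 0 <= q ->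
  0 <= duhamel_majorant alpha q n.
Proof.
move=> a0 q0; rewrite mulr_ge0 ?invr_ge0 ?ler0n//.
by apply: sumr_ge0 => k _; rewrite !mulr_ge0 ?exprn_ge0 ?invr_ge0 ?exprn_ge0 ?ler0n.
Qed.

(** A crude norm, chosen because it bounds all row sums at once and behaves
    well under powers: see [row_sum_mxX]. *)
Definition mx_abs_sum d (A : 'M[R]_d) : R := \sum_i \sum_j `|A i j|.

Lemma mx_abs_sum_ge0 d (A : 'M[R]_d) : 0 <= mx_abs_sum A.
Proof. by apply: sumr_ge0 => i _; exact: sumr_ge0. Qed.

Lemma row_sum_mxX d (A : 'M[R]_d) m i :
  \sum_j `|(A ^+ m) i j| <= mx_abs_sum A ^+ m.
Proof.
elim: m i => [|m ih] i.
  rewrite !expr0 (bigD1 i)//= big1 ?addr0 => [|j ji].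
    by rewrite [1]/(1%:M) mxE eqxx normr1.
  by rewrite [1]/(1%:M) mxE eq_sym (negbTE ji) normr0.
apply: (@le_trans _ _ (\sum_j \sum_k `|(A ^+ m) i k| * `|A k j|)).
  apply: ler_sum => j _; rewrite exprSr mxE.
  apply: le_trans (ler_norm_sum _ _ _) _.
  by apply: ler_sum => k _; rewrite normrM.
rewrite exchange_big exprSr; apply: (@le_trans _ _
    (\sum_k `|(A ^+ m) i k| * mx_abs_sum A)); last first.
  by rewrite -mulr_suml ler_wpM2r// mx_abs_sum_ge0.
apply: ler_sum => k _; rewrite -mulr_sumr ler_wpM2l//.
rewrite /mx_abs_sum [leRHS](bigD1 k)//= lerDl.
by apply: sumr_ge0 => l _; exact: sumr_ge0.
Qed.

End majorant.

Section covariance_terms.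
Context {R : realType} {d : nat}.
Variables (A : 'M[R]_d) (kappa : R -> 'M[R]_d).

(** The coefficient of the coordinate [a] of W_k in the degree n+1 part of the
    coordinate [i] of the response at time [t]. *)
Definition duhamel_coef (t : R) (n k : nat) (i a : 'I_d) : R :=
  t ^+ n.+1 / n.+1`!%:R * (A ^+ (n - k)) i a.

Lemma cov_termE t s n m i j :
  cov_term A kappa t s n.+1 m.+1 i j =
  \sum_(0 <= k < n.+1) \sum_(0 <= l < m.+1) \sum_a \sum_b
    duhamel_coef t n k i a * duhamel_coef s m l j b *
    deriv_cov kappa (k, a) (l, b).
Proof.
rewrite /cov_term mxE summxE mulr_sumr; apply: eq_bigr => k _.
rewrite summxE mulr_sumr; apply: eq_bigr => l _.
rewrite !subn1 /= mxE exchange_big /= mulr_sumr; apply: eq_bigr => b _.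
rewrite mxE mulr_suml mulr_sumr; apply: eq_bigr => a _.
rewrite !mxE /duhamel_coef /deriv_cov /= invfM; ring.
Qed.

Lemma duhamel_coef_sum t n i (q : R) : 0 <= q ->
  \sum_(0 <= k < n.+1) \sum_a `|duhamel_coef t n k i a| * (k`!%:R * q ^- k) <=
  `|t| ^+ n.+1 * duhamel_majorant (mx_abs_sum A) q n.
Proof.
move=> q0; rewrite /duhamel_majorant mulrA mulr_sumr; apply: ler_sum => k _.
rewrite -mulr_suml [leRHS]mulrA ler_wpM2r ?mulr_ge0 ?ler0n ?invr_ge0 ?exprn_ge0//.
under eq_bigr do rewrite normrM normrM normrX normfV (ger0_norm (ler0n _ _)).
by rewrite -mulr_sumr ler_wpM2l ?row_sum_mxX// mulr_ge0 ?exprn_ge0 ?invr_ge0 ?ler0n.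
Qed.

(** The factor 2^(k+l) lost in (k+l)! <= 2^(k+l) k! l! is the one gained from
    the radius of [kappa] being twice that of the noise. *)
Lemma deriv_cov_bound (q K : R) : 0 < q ->
  (forall n i j, `|(kappa^`(n))%classic 0 i j / n`!%:R| * (2 * q) ^+ n <= K) ->
  forall p p', `|deriv_cov kappa p p'| <=
    K * ((p.1`!%:R * q ^- p.1) * (p'.1`!%:R * q ^- p'.1)).
Proof.
move=> q0 hK [k a] [l b] /=; rewrite /deriv_cov /=.
rewrite normrM normrX normrN1 expr1n mul1r.
have := hK (k + l)%N a b; set x := (kappa^`(k + l))%classic 0 a b.
rewrite normrM normfV (ger0_norm (ler0n R _)) => hk.
have K0 : 0 <= K.
  apply: le_trans hk; rewrite mulr_ge0 ?exprn_ge0 ?mulr_ge0 ?(ltW q0)//.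
have F0 := @fact_gt0R R (k + l).
have q2 : 0 < (2 * q) ^+ (k + l) by rewrite exprn_gt0// mulr_gt0.
have hx : `|x| <= K * ((k + l)`!%:R / (2 * q) ^+ (k + l)).
  by rewrite mulrA ler_pdivlMr// -ler_pdivrMr// mulrAC.
apply: le_trans hx _; apply: ler_wpM2l => //.
rewrite ler_pdivrMr//.
have -> : k`!%:R * q ^- k * (l`!%:R * q ^- l) * (2 * q) ^+ (k + l) =
    2 ^+ (k + l) * (k`!%:R * l`!%:R).
  rewrite exprMn (exprD q); field; by rewrite !expf_neq0 ?gt_eqF.
rewrite -natrM -natrX -natrM ler_nat -(bin_fact (leq_addr l k)) addKn.
by rewrite leq_mul2r bin_leq_exp2 orbT.
Qed.

(** The bound on the covariances of the W_k factorises over the two indices,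
    which reduces the double series to two copies of [duhamel_majorant]. *)
Lemma cov_term_bound (t s q sg K : R) :
  (forall n i j, `|(kappa^`(n))%classic 0 i j / n`!%:R| * (2 * q) ^+ n <= K) ->
  `|t| < sg -> `|s| < sg -> sg < q ->
  exists C p : R, [/\ 0 <= C, 0 <= p < 1 & forall n m i j,
    `|cov_term A kappa t s n.+1 m.+1 i j| <= C * (p ^+ n * p ^+ m)].
Proof.
move=> hK tsg ssg sgq.
have sg0 : 0 < sg by apply: le_lt_trans tsg.
have q0 : 0 < q := lt_trans sg0 sgq.
have [M hM] := duhamel_majorant_bound (mx_abs_sum_ge0 A) sg0 sgq.
have M0 : 0 <= M.
  apply: le_trans (hM 0%N); rewrite mulr_ge0 ?exprn_ge0 ?(ltW sg0)//.
  by rewrite duhamel_majorant_ge0 ?mx_abs_sum_ge0 ?(ltW q0).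
have hM' n : duhamel_majorant (mx_abs_sum A) q n <= M / sg ^+ n.
  by rewrite ler_pdivlMr ?exprn_gt0.
pose r := Num.max `|t| `|s|.
have rsg : r < sg by rewrite gt_max tsg.
have r0 : 0 <= r by rewrite le_max normr_ge0.
have p01 : 0 <= r / sg < 1.
  by rewrite divr_ge0 ?(ltW sg0)//= ltr_pdivrMr// mul1r.
have hr (u : R) n : `|u| <= r -> `|u| ^+ n.+1 * duhamel_majorant (mx_abs_sum A) q n <=
    r * M * (r / sg) ^+ n.
  move=> ur; apply: (@le_trans _ _ (r ^+ n.+1 * (M / sg ^+ n))).
    apply: ler_pM => //; rewrite ?exprn_ge0//.
      by rewrite duhamel_majorant_ge0 ?mx_abs_sum_ge0 ?(ltW q0).
    by rewrite lerXn2r// nnegrE.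
  by rewrite exprS expr_div_n le_eqVlt; apply/orP; left; apply/eqP; ring.
have K0 (n : nat) (i j : 'I_d) : 0 <= K.
  apply: le_trans (hK n i j); rewrite mulr_ge0 ?exprn_ge0 ?mulr_ge0 ?(ltW q0)//.
exists (`|K| * (r * M) ^+ 2), (r / sg); split => //.
  by rewrite mulr_ge0 ?exprn_ge0 ?mulr_ge0.
move=> n m i j; rewrite cov_termE.
have k0 := K0 0%N i j; rewrite (ger0_norm k0).
pose u k a := `|duhamel_coef t n k i a| * (k`!%:R * q ^- k).
pose v l b := `|duhamel_coef s m l j b| * (l`!%:R * q ^- l).
apply: (@le_trans _ _ (\sum_(0 <= k < n.+1) \sum_(0 <= l < m.+1) \sum_a \sum_b
    K * (u k a * v l b))).
  do 4! (apply: le_trans (ler_norm_sum _ _ _) _; apply: ler_sum => ? _).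
  rewrite normrM normrM; apply: le_trans (ler_wpM2l _ (deriv_cov_bound q0 hK _ _)) _ => /=.
    by rewrite mulr_ge0.
  by rewrite /u /v le_eqVlt; apply/orP; left; apply/eqP; ring.
have -> : \sum_(0 <= k < n.+1) \sum_(0 <= l < m.+1) \sum_a \sum_b K * (u k a * v l b)
   = K * ((\sum_(0 <= k < n.+1) \sum_a u k a) * (\sum_(0 <= l < m.+1) \sum_b v l b)).
  rewrite mulr_suml mulr_sumr; apply: eq_bigr => k _.
  rewrite mulr_sumr mulr_sumr; apply: eq_bigr => l _.
  rewrite mulr_suml mulr_sumr; apply: eq_bigr => a _.
  by rewrite mulr_sumr mulr_sumr.
rewrite -mulrA ler_wpM2l//.
have -> : (r * M) ^+ 2 * ((r / sg) ^+ n * (r / sg) ^+ m) =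
  (r * M * (r / sg) ^+ n) * (r * M * (r / sg) ^+ m) by ring.
have pos (f : nat -> 'I_d -> R) N : (forall k a, 0 <= f k a) ->
    0 <= \sum_(0 <= k < N) \sum_a f k a.
  by move=> f0; apply: sumr_ge0 => k _; apply: sumr_ge0.
apply: ler_pM.
- by apply: pos => k a; rewrite /u !mulr_ge0 ?invr_ge0 ?exprn_ge0 ?(ltW q0).
- by apply: pos => k a; rewrite /v !mulr_ge0 ?invr_ge0 ?exprn_ge0 ?(ltW q0).
- apply: le_trans (hr t n _); last by rewrite le_max lexx.
  exact: duhamel_coef_sum (ltW q0).
- apply: le_trans (hr s m _); last by rewrite le_max lexx orbT.
  exact: duhamel_coef_sum (ltW q0).
Qed.

End covariance_terms.

(** * Summation over squares *)

Section box_sums.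
Context {R : realType}.

Lemma sum_split_sub (T : eqType) (s s' : seq T) (f : T -> R) :
  uniq s -> uniq s' -> {subset s <= s'} ->
  \sum_(x <- s') f x = \sum_(x <- s) f x + \sum_(x <- s' | x \notin s) f x.
Proof.
move=> us us' ss'; rewrite (bigID (mem s))/=; congr (_ + _).
rewrite -big_filter; apply: perm_big; apply: uniq_perm => //.
  exact: filter_uniq.
by move=> x; rewrite mem_filter andb_idr//; exact: ss'.
Qed.

Definition box (M : nat) : seq (nat * nat) :=
  [seq (n, m) | n <- iota 0 M, m <- iota 0 M].

Lemma mem_box M x : (x \in box M) = (x.1 < M)%N && (x.2 < M)%N.
Proof.
apply/allpairsP/idP => [[[n m] /= [+ + ->]]|/andP[h1 h2]].
  by rewrite !mem_iota /= !add0n => -> ->.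
by exists x; rewrite !mem_iota /= !add0n; case: x h1 h2.
Qed.

Lemma uniq_box M : uniq (box M).
Proof. by apply: allpairs_uniq; rewrite ?iota_uniq// => -[? ?] [? ?]. Qed.

Lemma sub_box M M' : (M <= M')%N -> {subset box M <= box M'}.
Proof. by move=> h x; rewrite !mem_box => /andP[h1 h2]; rewrite !(leq_trans _ h). Qed.

Lemma sum_box (f : nat -> nat -> R) M :
  \sum_(x <- box M) f x.1 x.2 = \sum_(0 <= n < M) \sum_(0 <= m < M) f n m.
Proof. by rewrite /box big_allpairs_dep /index_iota !subn0. Qed.

Lemma seq_sub_box (s : seq (nat * nat)) : exists M, {subset s <= box M}.
Proof.
elim: s => [|x s [M hM]]; first by exists 0%N.
exists (maxn M (maxn x.1 x.2).+1) => y; rewrite in_cons => /predU1P[->|/hM].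
  by rewrite mem_box !leq_max !ltnS !leq_max !leqnn ?orbT.
by apply: sub_box; exact: leq_maxl.
Qed.

Section dominated.
Variables (p : R) (p01 : 0 <= p < 1).

(** Bounds the sum of p^(n+m) over the indices outside the square [box M]: this
    sum is (1 - (1 - p^M)^2) / (1 - p)^2. *)
Definition box_tail (M : nat) : R := 2 * p ^+ M / (1 - p) ^+ 2.

Let p0 : 0 <= p. Proof. by case/andP: p01. Qed.
Let p1 : 0 < 1 - p. Proof. by rewrite subr_gt0; case/andP: p01. Qed.

Lemma geometric_box_tail M M' : (M <= M')%N ->
  \sum_(x <- box M' | x \notin box M) p ^+ x.1 * p ^+ x.2 <= box_tail M.
Proof.
move=> MM'.
have E N : \sum_(x <- box N) p ^+ x.1 * p ^+ x.2 = (\sum_(0 <= i < N) p ^+ i) ^+ 2.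
  rewrite (@sum_box (fun n m => p ^+ n * p ^+ m)) expr2 mulr_suml.
  by apply: eq_bigr => n _; rewrite mulr_sumr.
have := @sum_split_sub _ _ _ (fun x => p ^+ x.1 * p ^+ x.2) 
  (uniq_box M) (uniq_box M') (sub_box MM').
rewrite !E => /eqP; rewrite addrC -subr_eq => /eqP <-.
have geo N : \sum_(0 <= i < N) p ^+ i = (1 - p ^+ N) / (1 - p).
  apply/(canRL (mulfK _)); first by rewrite gt_eqF.
  by rewrite big_mkord mulrC -opprB mulNr -subrX1 opprB.
rewrite !geo !expr_div_n -mulrBl /box_tail ler_wpM2r ?invr_ge0 ?exprn_ge0 ?(ltW p1)//.
have pM N : 0 <= p ^+ N <= 1.
  by rewrite exprn_ge0// exprn_ile1//; case/andP: p01 => _ /ltW.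
have := pM M; have := pM M'; move=> /andP[a b] /andP[c e]; nra.
Qed.

Lemma geometric_box_tail_seq (s : seq (nat * nat)) M : uniq s ->
  {subset box M <= s} ->
  \sum_(x <- s | x \notin box M) p ^+ x.1 * p ^+ x.2 <= box_tail M.
Proof.
move=> us bs; have [M' hM'] := seq_sub_box s.
have hM2 : {subset s <= box (maxn M M')}.
  by move=> x /hM'; apply: sub_box; exact: leq_maxr.
apply: le_trans (geometric_box_tail (leq_maxl M M')).
rewrite -big_filter -[leRHS]big_filter.
rewrite (@sum_split_sub _ [seq x <- s | x \notin box M]
  [seq x <- box (maxn M M') | x \notin box M]) ?filter_uniq ?uniq_box//.
  by rewrite lerDl; apply: sumr_ge0 => x _; rewrite mulr_ge0 ?exprn_ge0.
by move=> x; rewrite !mem_filter => /andP[-> /hM2].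
Qed.

(** The error bound is uniform over all finite sets containing [box M]; this is
    what unconditional convergence asks for. *)
Lemma box_sums_cvg (C : R) (a : nat * nat -> R) : 0 <= C ->
  (forall x, `|a x| <= C * (p ^+ x.1 * p ^+ x.2)) ->
  exists S : R, (fun M => \sum_(x <- box M) a x) @ \oo --> S /\
    forall M (s : seq (nat * nat)), uniq s -> {subset box M <= s} ->
      `|S - \sum_(x <- s) a x| <= 2 * (C * box_tail M).
Proof.
move=> C0 aC; pose SM M := \sum_(x <- box M) a x.
have near_SM M s : uniq s -> {subset box M <= s} ->
    `|\sum_(x <- s) a x - SM M| <= C * box_tail M.
  move=> us bs; rewrite (sum_split_sub a (uniq_box M) us bs) addrAC subrr add0r.
  apply: le_trans (ler_norm_sum _ _ _) _.
  apply: le_trans (ler_wpM2l C0 (geometric_box_tail_seq us bs)).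
  by rewrite mulr_sumr; apply: ler_sum => x _; exact: aC.
have cS : cvgn SM.
  have -> : SM = series (fun k => SM k.+1 - SM k).
    apply/funext => M; rewrite /series/= telescope_sumr// [SM 0%N]big1_seq ?subr0//.
  apply: normed_cvg; pose q := C * (2 / (1 - p) ^+ 2).
  apply: (@series_le_cvg _ _ (geometric q p)) => //.
  - by move=> n /=.
  - by move=> n; rewrite /geometric/= !mulr_ge0 ?invr_ge0 ?exprn_ge0 ?(ltW p1).
  - move=> n; rewrite /geometric/=.
    apply: le_trans (near_SM n _ (uniq_box _) (sub_box (leqnSn _))) _.
    by rewrite /box_tail /q le_eqVlt; apply/orP; left; apply/eqP; ring.
  - apply: is_cvg_geometric_series; rewrite ger0_norm//; by case/andP: p01.
move/cvg_ex : (cS) => [S hS].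
exists S; split=> // M s us bs.
have hS' : (fun N => `|SM N - \sum_(x <- s) a x|) @ \oo --> `|S - \sum_(x <- s) a x|.
  by apply: cvg_norm; apply: cvgB => //; exact: cvg_cst.
rewrite -(cvg_lim _ hS')//; apply: limr_le; first by apply/cvg_ex; eexists; exact: hS'.
near=> N; have MN : (M <= N)%N by near: N; exact: nbhs_infty_ge.
rewrite -(subrKA (SM M)) (le_trans (ler_normD _ _))//.
rewrite mulr_natl mulr2n lerD//; last by rewrite distrC near_SM.
exact: near_SM (uniq_box _) (sub_box MN).
Unshelve. all: by end_near. Qed.

Lemma box_tail_cvg0 : box_tail @ \oo --> 0.
Proof.
rewrite /box_tail; have -> : 0 = 2 * 0 / (1 - p) ^+ 2 :> R by rewrite mulr0 mul0r.
apply: cvgMl; apply: cvgMr; apply: cvg_expr; rewrite ger0_norm//; by case/andP: p01.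
Qed.

(** The tail bound does not depend on the entry, so that one square serves for
    the whole matrix. *)
Lemma mx_has_sum d (C : R) (a : nat * nat -> 'M[R]_d) : 0 <= C ->
  (forall x i j, `|a x i j| <= C * (p ^+ x.1 * p ^+ x.2)) ->
  exists2 S : 'M[R]_d, has_sum a S &
    forall i j, (fun M => \sum_(x <- box M) a x i j) @ \oo --> S i j.
Proof.
move=> C0 aC.
have h i j := box_sums_cvg C0 (fun x => aC x i j).
pose S : 'M[R]_d := \matrix_(i, j) sval (cid (h i j)).
exists S => [e e0|i j]; last by rewrite mxE; case: cid => /= ? [].
have : (fun M => 2 * (C * box_tail M)) @ \oo --> 2 * (C * 0).
  by apply: cvgMr; apply: cvgMr; exact: box_tail_cvg0.
rewrite !mulr0 => /cvgr0Pnorm_lt /(_ _ (divr_gt0 e0 (ltr0n _ 2))).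
move=> [M _ /(_ M (leqnn _)) hM].
exists [fset x in box M]%fset => F sF.
apply: (@le_lt_trans _ _ (e / 2)); last by rewrite ltr_pdivrMr// ltr_pMr// ltr1n.
rewrite [leLHS]/Num.Def.normr/= mx_normrE; apply: bigmax_le => [|[i j] _ /=].
  by rewrite divr_ge0// ltW.
rewrite !mxE summxE; case: cid => T [_ hT] /=.
apply: le_trans (hT M F _ _) (le_trans (ler_norm _) (ltW hM)).
  exact: fset_uniq.
move=> x xM; apply: (fsubsetP sF); by rewrite inE.
Qed.

End dominated.
End box_sums.

(** * Matrix limits and uniqueness for linear equations *)

Section matrix_limits.
Context {R : realType} {m n : nat}.

Lemma cvg_mx_entry (u : nat -> 'M[R]_(m, n)) (l : 'M[R]_(m, n)) i j :
  u @ \oo --> l -> (fun k => u k i j) @ \oo --> l i j.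
Proof.
move=> ul; apply/cvgrPdist_le => e e0.
move/cvgrPdist_le : ul => /(_ _ e0); apply: filterS => k; apply: le_trans.
rewrite [leRHS]/Num.Def.normr/= mx_normrE.
by apply: le_trans; last exact: (le_bigmax _ _ (i, j)); rewrite /= !mxE.
Qed.

Lemma mx_entry_cvg (u : nat -> 'M[R]_(m, n)) (l : 'M[R]_(m, n)) :
  (forall i j, (fun k => u k i j) @ \oo --> l i j) -> u @ \oo --> l.
Proof.
move=> ul; apply/cvgrPdist_le => e e0.
have : \forall k \near \oo, forall ij : 'I_m * 'I_n, `|l ij.1 ij.2 - u k ij.1 ij.2| <= e.
  apply: filter_forall => -[i j] /=.
  by move/cvgrPdist_le : (ul i j) => /(_ _ e0).
apply: filterS => k h.
rewrite [leLHS]/Num.Def.normr/= mx_normrE (bigmax_le _ (ltW e0))//= => -[i j] _.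
by rewrite !mxE; exact: (h (i, j)).
Qed.

Lemma is_derive_mx (X : R -> 'M[R]_(m, n)) (t : R) (v : 'M[R]_(m, n)) :
  (forall i j, is_derive t (1 : R) (fun s => X s i j) (v i j)) -> is_derive t 1 X v.
Proof.
move=> h.
have dX : derivable X t 1 by apply/derivable_mxP => i j; have [] := h i j.
apply: DeriveDef => //; rewrite derive_mx//; apply/matrixP => i j.
by rewrite mxE; have [] := h i j.
Qed.

Lemma is_derive_mx_entry (X : R -> 'M[R]_(m, n)) (t : R) (v : 'M[R]_(m, n)) i j :
  is_derive t 1 X v -> is_derive t 1 (fun s => X s i j) (v i j).
Proof.
case=> dX vX; apply: DeriveDef; first by move/derivable_mxP : dX.
by have := derive_mx dX; rewrite vX => /matrixP /(_ i j); rewrite mxE.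
Qed.

End matrix_limits.

Section linear_ode_uniqueness.
Context {R : realType} {d : nat}.
Variables (A : 'M[R]_d) (D : set R).
Hypothesis D_ball : forall s t, `|s| <= `|t| -> D t -> D s.

Let energy (u : R -> 'cV[R]_d) (s : R) : R := \sum_i (u s i 0) ^+ 2.

Let energy_derive u (t : R) : is_derive t 1 u (A *m u t) ->
  is_derive t 1 (energy u) (\sum_i 2 * u t i 0 * (A *m u t) i 0).
Proof.
move=> du.
have -> : energy u = \sum_i (fun s => (u s i 0) ^+ 2).
  by apply/funext => s; rewrite fct_sumE.
apply: is_derive_sum => i.
have h := is_derive_mx_entry i 0 du.
by apply: is_derive_eq; rewrite /GRing.scale/=; ring.
Qed.

Let energy_bound (v : 'cV[R]_d) :
  `|\sum_i 2 * v i 0 * (A *m v) i 0| <=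
  2 * mx_abs_sum A * \sum_i (v i 0) ^+ 2.
Proof.
pose E := \sum_i (v i 0) ^+ 2.
have vE i j : `|v i 0| * `|v j 0| <= E.
  have h k : `|v k 0| ^+ 2 <= E.
    rewrite real_normK ?num_real// /E (bigD1 k)//= lerDl.
    by apply: sumr_ge0 => l _; exact: sqr_ge0.
  by have := h i; have := h j; have := sqr_ge0 (`|v i 0| - `|v j 0|); nra.
apply: le_trans (ler_norm_sum _ _ _) _.
rewrite /mx_abs_sum -mulrA mulr_suml mulr_sumr; apply: ler_sum => i _.
rewrite -mulrA normrM ger0_norm// ler_wpM2l// mxE mulr_sumr mulr_suml.
apply: le_trans (ler_norm_sum _ _ _) _; apply: ler_sum => j _.
rewrite mulrCA normrM ler_wpM2l// normrM; exact: vE.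
Qed.

Let energy_exp_derive u c (t : R) : is_derive t 1 u (A *m u t) ->
  is_derive t 1 (fun s => energy u s * expR (c * s))
    ((\sum_i 2 * u t i 0 * (A *m u t) i 0 + c * energy u t) * expR (c * t)).
Proof.
move=> /energy_derive de.
have dx : is_derive t 1 (fun s => expR (c * s)) (c * expR (c * t)).
  have dc : is_derive t 1 (fun s : R => c * s) c.
    by apply: is_derive_eq; rewrite /GRing.scale/=; ring.
  have h := @is_derive1_comp R expR (fun s => c * s) t _ _ (is_derive_expR _) dc.
  by apply: is_derive_eq; rewrite mulrC.
apply: is_derive_eq; rewrite /GRing.scale/=; ring.
Qed.

(** Gronwall's argument.  The energy E = |u|^2 satisfies |E'| <= c E with
    [c = 2 * mx_abs_sum A], so E(s) e^(-c s) decreases for s > 0 and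
    E(s) e^(c s) increases for s < 0; both vanish at 0. *)
Lemma linear_ode_zero (u : R -> 'cV[R]_d) : u 0 = 0 ->
  (forall t, D t -> is_derive t 1 u (A *m u t)) -> forall t, D t -> u t = 0.
Proof.
move=> u0 du t Dt.
have e0 : energy u 0 = 0 by rewrite /energy big1// => i _; rewrite u0 mxE expr0n.
have ege s : 0 <= energy u s by apply: sumr_ge0 => i _; exact: sqr_ge0.
have a0 := mx_abs_sum_ge0 A.
suff et : energy u t <= 0.
  apply/matrixP => i j; rewrite ord1 mxE; apply/eqP.
  rewrite -sqrf_eq0; apply/eqP/le_anti; rewrite sqr_ge0 andbT.
  apply: le_trans et; rewrite /energy (bigD1 i)//= lerDl.
  by apply: sumr_ge0 => k _; exact: sqr_ge0.
pose c := 2 * mx_abs_sum A.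
pose phi c s := energy u s * expR (c * s).
pose dphi c s := (\sum_i 2 * u s i 0 * (A *m u s) i 0 + c * energy u s) * expR (c * s).
have dP b s : D s -> is_derive s 1 (phi b) (dphi b s).
  by move=> Ds; apply: energy_exp_derive; exact: du.
have cP b s : D s -> {for s, continuous (phi b)}.
  move=> Ds; apply/differentiable_continuous/derivable1_diffP.
  by have [] := dP b s Ds.
have bnd s : `|\sum_i 2 * u s i 0 * (A *m u s) i 0| <= c * energy u s.
  exact: energy_bound.
have [t0|t0|t0] := ltrgt0P t; last by rewrite t0 e0.
- have Ds s : s \in `[0, t] -> D s.
    rewrite in_itv/= => /andP[s0 st]; apply: D_ball Dt.
    by rewrite !ger0_norm ?(ltW t0).
  have [s st||x xt] := @MVT R (phi (- c)) (dphi (- c)) 0 t t0.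
  + by apply: dP; apply: Ds; exact: subset_itv_oo_cc st.
  + by apply: continuous_in_subspaceT => s /set_mem st; apply: cP; exact: Ds.
  rewrite subr0 /phi e0 mul0r subr0 => E.
  have : energy u t * expR (- c * t) <= 0.
    rewrite E; apply: mulr_le0_ge0; last exact: ltW.
    apply: mulr_le0_ge0; last exact: expR_ge0.
    by have := bnd x; rewrite ler_norml => /andP[_]; rewrite mulNr subr_le0.
  by rewrite pmulr_lle0 ?expR_gt0.
- have Ds s : s \in `[t, 0] -> D s.
    rewrite in_itv/= => /andP[s0 st]; apply: D_ball Dt.
    by rewrite !ler0_norm ?(ltW t0)// lerN2.
  have [s st||x xt] := @MVT R (phi c) (dphi c) t 0 t0.
  + by apply: dP; apply: Ds; exact: subset_itv_oo_cc st.
  + by apply: continuous_in_subspaceT => s /set_mem st; apply: cP; exact: Ds.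
  rewrite sub0r /phi e0 mul0r sub0r => E.
  have : 0 <= - (energy u t * expR (c * t)).
    rewrite E; apply: mulr_ge0; last by rewrite oppr_ge0 ltW.
    apply: mulr_ge0; last exact: expR_ge0.
    by have := bnd x; rewrite ler_norml => /andP[+ _]; rewrite -subr_ge0 opprK.
  by rewrite oppr_ge0 pmulr_lle0 ?expR_gt0.
Qed.

Lemma linear_ode_unique (f x y : R -> 'cV[R]_d) : x 0 = y 0 ->
  (forall t, D t -> is_derive t 1 x (A *m x t + f t)) ->
  (forall t, D t -> is_derive t 1 y (A *m y t + f t)) ->
  forall t, D t -> x t = y t.
Proof.
move=> xy0 dx dy t Dt; apply/eqP; rewrite -subr_eq0; apply/eqP.
apply: (@linear_ode_zero (x - y)) => // [|s Ds].
  by rewrite fctE xy0 subrr.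
have := dx s Ds; have := dy s Ds => dys dxs.
by apply: is_derive_eq; rewrite fctE mulmxBr opprD addrACA subrr addr0.
Qed.

End linear_ode_uniqueness.

(** * Power series solutions of linear equations *)

Section power_series_solution.
Context {R : realType}.

(** Differentiation multiplies the terms by n, which any loss of radius
    absorbs: (n+1) p^n <= 1 / (1-p). *)
Lemma gbounded_diffs (r q : R) a : 0 < r -> r < q -> gbounded q a ->
  gbounded r (pseries_diffs a).
Proof.
move=> r0 rq [C hC]; have q0 := lt_trans r0 rq.
have p01 : 0 <= r / q < 1 by rewrite divr_ge0 ?(ltW r0) ?(ltW q0)//= ltr_pdivrMr// mul1r.
exists (C / q * (1 - r / q)^-1) => n.
have C0 : 0 <= C by apply: le_trans (hC 0%N); rewrite mulr_ge0.
have np : n.+1%:R * (r / q) ^+ n <= (1 - r / q)^-1.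
  apply: le_trans (geometric_sum_le n.+1 p01).
  rewrite mulr_natl -[X in _ *+ X]subn0 -sumr_const_nat big_nat [leRHS]big_nat.
  apply: ler_sum => i /andP[_ ni]; case/andP: p01 => p0 /ltW p1.
  by apply: ler_wiXn2l => //; rewrite p0.
apply: le_trans (ler_wpM2l _ np); last by rewrite divr_ge0 ?(ltW q0).
rewrite /pseries_diffs normrM normr_nat -[leLHS]mulrA.
rewrite [leRHS]mulrCA ler_wpM2l// expr_div_n mulrA ler_pdivlMr ?exprn_gt0//.
rewrite mulrAC ler_wpM2r ?exprn_ge0 ?(ltW r0)//.
by rewrite ler_pdivlMr// -mulrA -exprSr.
Qed.

Lemma gboundedD (r : R) a b : 0 <= r -> gbounded r a -> gbounded r b ->
  gbounded r (fun n => a n + b n).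
Proof.
move=> r0 [C hC] [E hE]; exists (C + E) => n.
apply: le_trans (lerD (hC n) (hE n)); rewrite -mulrDl ler_wpM2r ?exprn_ge0//.
exact: ler_normD.
Qed.

Lemma gboundedZ (r k : R) a : gbounded r a -> gbounded r (fun n => k * a n).
Proof.
by move=> [C hC]; exists (`|k| * C) => n; rewrite normrM -mulrA ler_wpM2l.
Qed.

Lemma gbounded_sum (r : R) (I : Type) (s : seq I) (a : I -> nat -> R) : 0 <= r ->
  (forall i, gbounded r (a i)) -> gbounded r (fun n => \sum_(i <- s) a i n).
Proof.
move=> r0 h; elim: s => [|i s ih].
  by exists 0 => n; rewrite big_nil normr0 mul0r.
by under [X in gbounded _ X]eq_fun do rewrite big_cons; exact: gboundedD.
Qed.

Variables (d : nat) (A : 'M[R]_d) (D : set R).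
Hypothesis D_open : forall t, D t -> exists2 t' : R, `|t| < t' & D t'.

Section recursion.
Variables (y g : nat -> 'cV[R]_d).
Hypothesis y_rec : forall n, n.+1%:R *: y n.+1 = A *m y n + g n.
Hypothesis y_bound : forall q, D q -> 0 < q -> forall i, gbounded q (fun n => y n i 0).
Hypothesis g_bound : forall q, D q -> 0 < q -> forall i, gbounded q (fun n => g n i 0).

Definition pseries_mx (t : R) : 'cV[R]_d :=
  \col_i limn (pseries (fun n => y n i 0) t).

Let bounded_cvg (c : nat -> R) t : (forall q, D q -> 0 < q -> gbounded q c) ->
  D t -> cvgn (pseries c t).
Proof.
move=> h Dt; have [q tq Dq] := D_open Dt.
have q0 : 0 < q := le_lt_trans (normr_ge0 _) tq.
by apply: (gbounded_cvg q0 (h q Dq q0)).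
Qed.

Lemma pseries_mx_cvg t i : D t ->
  pseries (fun n => y n i 0) t @ \oo --> pseries_mx t i 0.
Proof. by move=> Dt; rewrite mxE; apply: bounded_cvg => // q Dq q0; exact: y_bound. Qed.

Let diffsE i : pseries_diffs (fun n => y n i 0) =
  (fun n => \sum_j A i j * y n j 0 + g n i 0).
Proof.
apply/funext => n; have /matrixP /(_ i 0) := y_rec n.
by rewrite !mxE.
Qed.

(** Term by term differentiation, where the recursion expresses the
    differentiated coefficients through [y] and [g]. *)
Lemma pseries_mx_derive (f : 'cV[R]_d) t : D t ->
  (forall i, pseries (fun n => g n i 0) t @ \oo --> f i 0) ->
  is_derive t 1 pseries_mx (A *m pseries_mx t + f).
Proof.
move=> Dt hf; apply: is_derive_mx => i j; rewrite (ord1 j) {j}.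
have [K tK DK] := D_open Dt.
have K0 : 0 < K := le_lt_trans (normr_ge0 _) tK.
have bd q : D q -> 0 < q -> gbounded q (pseries_diffs (fun n => y n i 0)).
  move=> Dq q0; rewrite diffsE; apply: gboundedD; [exact: ltW| |exact: g_bound].
  by apply: gbounded_sum; [exact: ltW|move=> k; apply: gboundedZ; exact: y_bound].
have cdd : cvgn (pseries (pseries_diffs (pseries_diffs (fun n => y n i 0))) K).
  have [q Kq Dq] := D_open DK; rewrite (ger0_norm (ltW K0)) in Kq.
  pose r := (K + q) / 2.
  have r0 : 0 < r by rewrite /r; lra.
  apply: (@gbounded_cvg _ r) => //; last by rewrite ger0_norm ?ltW// /r; lra.
  apply: (@gbounded_diffs r q) => //; first by rewrite /r; lra.
  by apply: bd => //; lra.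
have c0 : cvgn (pseries (fun n => y n i 0) K).
  by apply: bounded_cvg DK => q Dq q0; exact: y_bound.
have c1 : cvgn (pseries (pseries_diffs (fun n => y n i 0)) K).
  exact: bounded_cvg DK.
have tK' : `|t| < `|K| by rewrite (ger0_norm (ltW K0)).
have := pseries_snd_diffs c0 c1 cdd tK'.
have -> : (fun x => limn (pseries (fun n => y n i 0) x)) = (fun s => pseries_mx s i 0).
  by apply/funext => s; rewrite mxE.
have -> : limn (pseries (pseries_diffs (fun n => y n i 0)) t) = (A *m pseries_mx t + f) i 0.
  apply/cvg_lim => //.
  have -> : pseries (pseries_diffs (fun n => y n i 0)) t = (fun N =>
      \sum_j A i j * pseries (fun n => y n j 0) t N + pseries (fun n => g n i 0) t N).
    apply/funext => N; rewrite /pseries/series/= diffsE.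
    under eq_bigr do rewrite mulrDl mulr_suml.
    rewrite big_split/= exchange_big/=; congr (_ + _); apply: eq_bigr => j _.
    by rewrite mulr_sumr; apply: eq_bigr => k _; rewrite mulrA.
  rewrite mxE mxE; apply: cvgD => //.
  by apply: cvg_sum_seq => j _; apply: cvgMr; exact: pseries_mx_cvg.
exact.
Qed.

End recursion.

Section exponential.
Variable z : 'cV[R]_d.

Let y (n : nat) : 'cV[R]_d := n`!%:R^-1 *: (A ^+ n *m z).

Let y_rec n : n.+1%:R *: y n.+1 = A *m y n + 0.
Proof.
rewrite addr0 /y -scalemxAr scalerA factS natrM invfM mulrA mulfV ?pnatr_eq0// mul1r.
by rewrite exprS mulmxA.
Qed.

Let entry_bound (r : R) i j : 0 <= r ->
  gbounded r (fun n => n`!%:R^-1 * (A ^+ n) i j).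
Proof.
move=> r0; have [E hE] := exp_terms_bounded (mulr_ge0 (mx_abs_sum_ge0 A) r0).
exists E => n; apply: le_trans (hE n).
rewrite normrM normfV normr_nat exprMn -[leLHS]mulrA [leLHS]mulrC.
rewrite ler_wpM2r ?invr_ge0 ?ler0n// ler_wpM2r ?exprn_ge0//.
apply: le_trans (row_sum_mxX A n i); rewrite (bigD1 j)//= lerDl.
exact: sumr_ge0.
Qed.

Let y_bound q i : 0 < q -> gbounded q (fun n => y n i 0).
Proof.
move=> q0; have -> : (fun n => y n i 0) =
    (fun n => \sum_j z j 0 * (n`!%:R^-1 * (A ^+ n) i j)).
  apply/funext => n; rewrite /y mxE mxE mulr_sumr; apply: eq_bigr => j _; ring.
by apply: gbounded_sum => [|j]; [exact: ltW|apply: gboundedZ; exact/entry_bound/ltW].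
Qed.

Let scale_mxX (t : R) n : (t *: A) ^+ n = t ^+ n *: A ^+ n.
Proof.
elim: n => [|n ih]; first by rewrite !expr0 scale1r.
by rewrite !exprS ih -[_ * _]/(_ *m _) -scalemxAl -scalemxAr scalerA.
Qed.

(** The exponential is treated as the power series solution of the equation
    without forcing. *)
Lemma expmx_pseries t : expmx (t *: A) *m z = pseries_mx y t.
Proof.
have r0 : 0 < `|t| + 1 by rewrite ltr_wpDl.
have tr : `|t| < `|t| + 1 by rewrite ltrDl.
pose E : 'M[R]_d := \matrix_(i, j) limn (pseries (fun n => n`!%:R^-1 * (A ^+ n) i j) t).
have cE i j : pseries (fun n => n`!%:R^-1 * (A ^+ n) i j) t @ \oo --> E i j.
  by rewrite mxE; apply: (gbounded_cvg r0 (entry_bound _ _ (ltW r0))).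
have -> : expmx (t *: A) = E.
  apply/cvg_lim => //; apply: mx_entry_cvg => i j.
  have -> : (fun k => series (fun k => k`!%:R^-1 *: (t *: A) ^+ k) k i j) =
      pseries (fun n => n`!%:R^-1 * (A ^+ n) i j) t.
    apply/funext => N; rewrite /pseries /series/= summxE; apply: eq_bigr => k _.
    rewrite scale_mxX !mxE; ring.
  exact: cE.
apply/matrixP => i j; rewrite ord1 !mxE; apply/esym/cvg_lim => //.
have -> : pseries (fun n => y n i 0) t = (fun N =>
    \sum_j pseries (fun n => n`!%:R^-1 * (A ^+ n) i j) t N * z j 0).
  apply/funext => N; rewrite /pseries /series/=.
  under [RHS]eq_bigr do rewrite mulr_suml.
  rewrite exchange_big/=; apply: eq_bigr => k _.
  rewrite /y mxE mxE mulr_sumr mulr_suml; apply: eq_bigr => l _; ring.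
by apply: cvg_sum_seq => k _; apply: cvgMl; exact: cE.
Qed.

Lemma expmx_derive t : D t ->
  is_derive t 1 (fun s => expmx (s *: A) *m z) (A *m (expmx (t *: A) *m z)).
Proof.
move=> Dt; have -> : (fun s => expmx (s *: A) *m z) = pseries_mx y.
  by apply/funext => s; exact: expmx_pseries.
rewrite expmx_pseries -[X in is_derive _ _ _ X]addr0.
apply: (@pseries_mx_derive y (fun=> 0)) => //.
- by move=> q _ q0 i; exact: y_bound.
- by move=> q _ _ i; exists 0 => n; rewrite mxE normr0 mul0r.
- move=> i; rewrite mxE; apply: cvg_near_cst; apply: nearW => N.
  by rewrite /pseries /series/= big1// => k _; rewrite mul0r.
Qed.

Lemma expmx0 : expmx (0 *: A) *m z = z.
Proof.
rewrite expmx_pseries; apply/matrixP => i j; rewrite ord1 mxE.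
apply/cvg_lim => //; rewrite -(cvg_shiftn 1); apply: cvg_near_cst; apply: nearW => N.
rewrite /pseries /series/= addn1 big_nat_recl//= big1 ?addr0 => [|k _].
  by rewrite /y mxE fact0 invr1 mul1r expr0 mulr1 mul1mx.
by rewrite expr0n mulr0.
Qed.

End exponential.

Section duhamel.
Variables (V : nat -> 'cV[R]_d).
Hypothesis V_bound : forall q, D q -> 0 < q -> forall i,
  gbounded q (fun n => V n i 0 / n`!%:R).

(** The Taylor coefficients at 0 of the solution vanishing at 0 whose forcing
    term has derivatives [V k] at 0. *)
Definition duhamel_series (n : nat) : 'cV[R]_d :=
  n`!%:R^-1 *: \sum_(0 <= k < n) A ^+ (n.-1 - k) *m V k.

Lemma duhamel_series0 : duhamel_series 0 = 0.
Proof. by rewrite /duhamel_series big_nil scaler0. Qed.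

Let y_rec n : n.+1%:R *: duhamel_series n.+1 =
  A *m duhamel_series n + n`!%:R^-1 *: V n.
Proof.
rewrite /duhamel_series -scalemxAr scalerA factS natrM invfM mulrA mulfV ?pnatr_eq0//.
rewrite mul1r -scalerDr; congr (_ *: _).
rewrite big_nat_recr//= subnn expr0 mul1mx; congr (_ + _).
rewrite mulmx_sumr big_nat [RHS]big_nat; apply: eq_bigr => k /andP[_ kn].
by case: n kn => // n kn; rewrite subSn// exprS mulmxA.
Qed.

Let y_bound q : D q -> 0 < q -> forall i, gbounded q (fun n => duhamel_series n i 0).
Proof.
move=> Dq q0 i; have [q' qq' Dq'] := D_open Dq.
rewrite (ger0_norm (ltW q0)) in qq'.
have q'0 := lt_trans q0 qq'.
have [C hC] : exists C, forall n j, `|V n j 0| <= C * (n`!%:R * q' ^- n).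
  have h := V_bound Dq' q'0.
  pose c j := sval (cid (h j)).
  have hc j n : `|V n j 0 / n`!%:R| * q' ^+ n <= c j by rewrite /c; case: cid.
  exists (\sum_j `|c j|) => n j.
  have F0 := @fact_gt0R R n.
  rewrite mulrCA mulrC -ler_pdivrMr// ler_pdivlMr ?exprn_gt0//.
  rewrite -[X in _ / X]ger0_norm ?ler0n// -normfV -normrM.
  apply: le_trans (hc j n) (le_trans (ler_norm _) _).
  rewrite (bigD1 j)//= lerDl; exact: sumr_ge0.
have [K hK] := duhamel_majorant_bound (mx_abs_sum_ge0 A) q0 qq'.
have C0 : 0 <= C.
  have := hC 0%N i; rewrite fact0 expr0 invr1 !mulr1; exact: le_trans.
exists (C * K * q) => -[|n].
  rewrite duhamel_series0 mxE normr0 mul0r.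
  rewrite !mulr_ge0 ?(ltW q0)//; apply: le_trans (hK 0%N).
  by rewrite mulr_ge0 ?exprn_ge0 ?(ltW q0)// duhamel_majorant_ge0 ?mx_abs_sum_ge0 ?(ltW q'0).
rewrite exprSr mulrA ler_wpM2r ?(ltW q0)//.
apply: le_trans (ler_wpM2l C0 (hK n)); rewrite mulrA ler_wpM2r ?exprn_ge0 ?(ltW q0)//.
rewrite /duhamel_series mxE normrM normfV normr_nat /duhamel_majorant mulrCA.
rewrite ler_wpM2l ?invr_ge0 ?ler0n// summxE mulr_sumr.
apply: le_trans (ler_norm_sum _ _ _) _; apply: ler_sum => k _ /=.
rewrite mxE; apply: le_trans (ler_norm_sum _ _ _) _.
apply: (@le_trans _ _ (\sum_j `|(A ^+ (n - k)) i j| * (C * (k`!%:R * q' ^- k)))).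
  by apply: ler_sum => j _; rewrite normrM ler_wpM2l.
rewrite -mulr_suml [leRHS]mulrCA ler_wpM2r ?row_sum_mxX//.
by rewrite !mulr_ge0 ?ler0n ?invr_ge0 ?exprn_ge0 ?(ltW q'0).
Qed.

Lemma duhamel_cvg t i : D t ->
  pseries (fun n => duhamel_series n i 0) t @ \oo --> pseries_mx duhamel_series t i 0.
Proof. exact: pseries_mx_cvg. Qed.

Lemma duhamel_derive (f : 'cV[R]_d) t : D t ->
  (forall i, pseries (fun n => V n i 0 / n`!%:R) t @ \oo --> f i 0) ->
  is_derive t 1 (pseries_mx duhamel_series) (A *m pseries_mx duhamel_series t + f).
Proof.
move=> Dt hf; apply: (pseries_mx_derive y_rec) => //.
- move=> q Dq q0 i; have := V_bound Dq q0 i.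
  by congr gbounded; apply/funext => n; rewrite mxE mulrC.
- move=> i.
  rewrite (_ : (fun n => _) = (fun n => V n i 0 / n`!%:R)); first exact: hf.
  by apply/funext => n; rewrite mxE mulrC.
Qed.

Lemma duhamel_at0 : pseries_mx duhamel_series 0 = 0.
Proof.
apply/matrixP => i j; rewrite ord1 !mxE.
apply/cvg_lim => //; rewrite -(cvg_shiftn 1); apply: cvg_near_cst; apply: nearW => N.
rewrite /pseries /series/= addn1 big_nat_recl//= big1 ?addr0 => [|k _].
  by rewrite duhamel_series0 mxE mul0r.
by rewrite expr0n mulr0.
Qed.

(** Identifies the partial sums of the path series with the combinations to
    which [gaussian_family_lim] is applied. *)
Lemma duhamel_partial_sum t i M :
  pseries (fun n => duhamel_series n i 0) t M.+1 =
  \sum_(0 <= n < M) \sum_(0 <= k < n.+1) \sum_a duhamel_coef A t n k i a * V k a 0.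
Proof.
rewrite /pseries /series/= big_nat_recl//= duhamel_series0 mxE mul0r add0r.
apply: eq_bigr => n _; rewrite /duhamel_series mxE summxE mulr_sumr mulr_suml.
apply: eq_bigr => k _; rewrite mxE mulr_sumr mulr_suml; apply: eq_bigr => a _.
rewrite /duhamel_coef/=; ring.
Qed.

End duhamel.
End power_series_solution.

(** * Analytic functions and the time interval *)

Section analytic_functions.
Context {R : realType} {m n : nat}.

Lemma series_taylor_entry (f : R -> 'M[R]_(m, n)) t i j :
  (fun N => series (fun k => t ^+ k *: taylor_coef f k) N i j) =
  pseries (fun k => (f^`(k))%classic 0 i j / k`!%:R) t.
Proof.
apply/funext => N; rewrite /pseries /series/= summxE; apply: eq_bigr => k _.
by rewrite /taylor_coef !mxE mulrC (mulrC _^-1).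
Qed.

Lemma analytic_around0_entries (D : set R) (f : R -> 'M[R]_(m, n)) (r : \bar R) e :
  0 < e -> (forall t, `|t| <= e -> D t) -> analytic_around0 D f r ->
  exists2 r' : R, 0 < r' & forall t, `|t| < r' -> forall i j,
    pseries (fun k => (f^`(k))%classic 0 i j / k`!%:R) t @ \oo --> f t i j.
Proof.
move=> e0 De [r0 _ hf].
have [r' r'0 hr'] : exists2 r' : R, 0 < r' & forall t, `|t| < r' -> (`|t|%:E < r)%E /\ D t.
  case: r r0 {hf} => [r| |]//= r0.
    exists (Num.min e r); first by rewrite lt_min e0.
    by move=> t; rewrite lt_min lte_fin => /andP[te tr]; split => //; exact/De/ltW.
  by exists e => // t te; split; [exact: ltry|exact/De/ltW].
exists r' => // t tr' i j; have [tr Dt] := hr' t tr'.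
rewrite -series_taylor_entry.
by apply: cvg_mx_entry; exact: hf.
Qed.

Lemma analytic_around0_bounded (D : set R) (f : R -> 'M[R]_(m, n)) (r : \bar R) q :
  analytic_around0 D f r -> 0 < q -> (q%:E < r)%E ->
  exists K, forall k i j, `|(f^`(k))%classic 0 i j / k`!%:R| * q ^+ k <= K.
Proof.
move=> [_ hr _] q0; rewrite -hr => /ereal_sup_gt [_ [p [p0 cp] <-]]; rewrite lte_fin => qp.
have h i j : gbounded q (fun k => (f^`(k))%classic 0 i j / k`!%:R).
  apply: (gbounded_le (ltW q0) (ltW qp)); apply: pseries_gbounded => //.
  move/cvg_ex : cp => [l hl]; apply/cvg_ex; exists (l i j).
  rewrite -series_taylor_entry.
  exact: cvg_mx_entry.
pose c i j := sval (cid (h i j)).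
have hc i j k : `|(f^`(k))%classic 0 i j / k`!%:R| * q ^+ k <= c i j by rewrite /c; case: cid.
exists (\sum_i \sum_j `|c i j|) => k i j.
apply: le_trans (hc i j k) (le_trans (ler_norm _) _).
rewrite (bigD1 i)//= (bigD1 j)//= -addrA lerDl addr_ge0 ?sumr_ge0// => l _.
exact: sumr_ge0.
Qed.

(** The Cauchy estimates bound the radius of convergence from below by every
    point of [D], and by definition the series represents [f] within its
    radius. *)
Lemma analytic_around0_extend (D : set R) (f : R -> 'M[R]_(m, n)) (r : \bar R) :
  (forall t, D t -> exists2 t' : R, `|t| < t' & D t') ->
  analytic_around0 D f r ->
  (forall q, D q -> 0 < q -> forall i j,
    gbounded q (fun k => (f^`(k))%classic 0 i j / k`!%:R)) ->
  forall t, D t -> forall i j,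
    pseries (fun k => (f^`(k))%classic 0 i j / k`!%:R) t @ \oo --> f t i j.
Proof.
move=> D_open [_ hr hf] bd t Dt i j.
rewrite -series_taylor_entry.
apply: cvg_mx_entry; apply: hf => //.
have [q tq Dq] := D_open t Dt.
have q0 : 0 < q := le_lt_trans (normr_ge0 _) tq.
have [q' qq' Dq'] := D_open q Dq; have q'0 : 0 < q' := le_lt_trans (normr_ge0 _) qq'.
apply: (@lt_le_trans _ _ q%:E); first by rewrite lte_fin.
rewrite -hr; apply: ereal_sup_ubound; exists q => //; split; first exact: ltW.
apply/cvg_ex; exists (\matrix_(i, j)
    limn (pseries (fun k => (f^`(k))%classic 0 i j / k`!%:R) q)).
apply: mx_entry_cvg => k l; rewrite mxE.
rewrite series_taylor_entry.
exact: gbounded_cvg q'0 (bd q' Dq' q'0 k l) qq'.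
Qed.

End analytic_functions.

Section time_interval_facts.
Context {R : realType} {d : nat}.
Variables (A : 'M[R]_d) (rho : \bar R).
Hypothesis hrho : (0 < rho)%E.
Let D := time_interval rho (rate A).

Let rate_ge1 : 1 <= rate A. Proof. by rewrite /rate le_max lexx. Qed.

Let rate_inv : 0 < (rate A)^-1 <= 1.
Proof.
by rewrite invr_gt0 invf_le1 (lt_le_trans ltr01 rate_ge1) ?rate_ge1.
Qed.

Lemma time_interval_ball s t : `|s| <= `|t| -> D t -> D s.
Proof. by move=> st; apply: le_lt_trans; rewrite lee_fin. Qed.

Lemma time_interval0 : D 0.
Proof.
by rewrite /D /time_interval/= normr0 mule_gt0// lte_fin; case/andP: rate_inv.
Qed.

(** Leaves room for the loss of radius in each estimate. *)
Lemma time_interval_open t : D t -> exists2 t' : R, `|t| < t' & D t'.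
Proof.
rewrite /D /time_interval/=; case: (_ * _)%E => [r| |]//=.
- rewrite lte_fin => tr; exists ((`|t| + r) / 2); first by lra.
  by rewrite lte_fin ger0_norm; have := normr_ge0 t; lra.
- by move=> _; exists (`|t| + 1); rewrite ?ltrDl ?ltry.
Qed.

(** The rate is at least 1. *)
Lemma time_interval_lt t : D t -> (`|t|%:E < rho)%E.
Proof.
move/lt_le_trans; apply; have /andP[l0 l1] := rate_inv.
case: rho hrho => [r| |]//= r0; last by rewrite leey.
by rewrite -EFinM lee_fin ler_piMr// ltW.
Qed.

Lemma time_interval_nbhs : exists2 e : R, 0 < e & forall t, `|t| <= e -> D t.
Proof.
have [e] := time_interval_open time_interval0; rewrite normr0 => e0 De.
by exists e => // t te; apply: time_interval_ball De; rewrite (ger0_norm (ltW e0)).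
Qed.

Lemma lags_nbhs e : (forall t, `|t| <= e -> D t) -> forall t, `|t| <= e -> lags D t.
Proof.
by move=> De t te; exists 0; rewrite add0r; split; [exact: time_interval0|exact: De].
Qed.

Lemma time_interval_lt2 q : D q -> 0 < q -> ((2 * q)%:E < 2%:E * rho)%E.
Proof.
move=> /time_interval_lt + q0; rewrite (ger0_norm (ltW q0)) => qr.
by rewrite EFinM lte_pmul2l// lte_fin.
Qed.

End time_interval_facts.

(** * The solution process *)

Section solution.
Context {R : realType} {dOm : measure_display} {Om : measurableType dOm}.
Variable P : probability Om R.
Variables (d : nat) (A : 'M[R]_d) (z : 'cV[R]_d) (D : set R).
Variables (kappa : R -> 'M[R]_d) (W : nat * 'I_d -> Om -> R) (G : set Om).
Hypothesis D_open : forall t, D t -> exists2 t' : R, `|t| < t' & D t'.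
Hypothesis gW : gaussian_family P setT W (deriv_cov kappa).
Hypothesis kappa_bound : forall q, D q -> 0 < q -> exists K, forall n i j,
  `|(kappa^`(n))%classic 0 i j / n`!%:R| * (2 * q) ^+ n <= K.
Hypothesis mG : measurable G.
Hypothesis G1 : P (~` G) = 0%E.
Hypothesis W_bound : forall om, G om -> forall q, D q -> 0 < q -> forall i,
  gbounded q (fun n => W (n, i) om / n`!%:R).

Definition deriv_vec (om : Om) (k : nat) : 'cV[R]_d := \col_a W (k, a) om.

(** Set to 0 outside the event [G] on which the path series converges, so as to
    be measurable everywhere. *)
Definition response (t : R) (om : Om) : 'cV[R]_d :=
  if om \in G then pseries_mx (duhamel_series A (deriv_vec om)) t else 0.

(** The deterministic solution of the equation without noise, plus the solution
    vanishing at time 0 of the equation with noise. *)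
Definition solution (t : R) (om : Om) : 'cV[R]_d :=
  expmx (t *: A) *m z + response t om.

Let deriv_vec_bound om : G om -> forall q, D q -> 0 < q -> forall i,
  gbounded q (fun n => deriv_vec om n i 0 / n`!%:R).
Proof.
move=> Gom q Dq q0 i; have := W_bound Gom Dq q0 i.
by congr gbounded; apply/funext => n; rewrite mxE.
Qed.

Lemma solution_derive om (f : R -> 'cV[R]_d) t : G om -> D t ->
  (forall i, pseries (fun n => W (n, i) om / n`!%:R) t @ \oo --> f t i 0) ->
  is_derive t 1 (solution ^~ om) (A *m solution t om + f t).
Proof.
move=> Gom Dt hf.
have -> : solution ^~ om =
    (fun s => expmx (s *: A) *m z) + pseries_mx (duhamel_series A (deriv_vec om)).
  by apply/funext => s; rewrite /solution /response mem_set// fctE.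
have h1 := expmx_derive A D_open z Dt.
have h2 : is_derive t 1 (pseries_mx (duhamel_series A (deriv_vec om)))
    (A *m pseries_mx (duhamel_series A (deriv_vec om)) t + f t).
  apply: (duhamel_derive A D_open (deriv_vec_bound Gom) Dt) => i.
  rewrite (_ : (fun n => _) = (fun n => W (n, i) om / n`!%:R)); first exact: hf.
  by apply/funext => n; rewrite mxE.
by apply: is_derive_eq; rewrite /solution /response mem_set// mulmxDr addrA.
Qed.

Lemma solution0 om : G om -> solution 0 om = z.
Proof.
move=> Gom; rewrite /solution /response mem_set// duhamel_at0 addr0.
exact: expmx0.
Qed.

Definition response_coord (p : R * 'I_d) (om : Om) : R := response p.1 om p.2 0.

Definition response_cov (p q : R * 'I_d) : R :=
  limn (fun M => \sum_(x <- box M)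
    cov_term A kappa p.1 q.1 x.1.+1 x.2.+1 p.2 q.2).

Lemma cov_term_has_sum t s : D t -> D s -> exists2 C : 'M[R]_d,
  has_sum (fun nm : nat * nat => cov_term A kappa t s nm.1.+1 nm.2.+1) C &
  forall i j, (fun M => \sum_(x <- box M)
    cov_term A kappa t s x.1.+1 x.2.+1 i j) @ \oo --> C i j.
Proof.
move=> Dt Ds.
have [q [tq sq Dq]] : exists q, [/\ `|t| < q, `|s| < q & D q].
  have [q1 tq1 Dq1] := D_open Dt; have [q2 sq2 Dq2] := D_open Ds.
  by have [q12|q21] := leP q1 q2; [exists q2|exists q1]; split => //; lra.
have [q' qq' Dq'] := D_open Dq.
have q0 : 0 < q := le_lt_trans (normr_ge0 _) tq.
rewrite (ger0_norm (ltW q0)) in qq'.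
have [K hK] := kappa_bound Dq' (lt_trans q0 qq').
have [C [p [C0 p01 hC]]] := cov_term_bound A hK tq sq qq'.
by apply: (mx_has_sum p01 C0) => x i j; exact: hC.
Qed.

(* the partial sum of the response at time [p.1], coordinate [p.2] *)
Let L (M : nat) (p : R * 'I_d) : seq (R * (nat * 'I_d)) :=
  [seq (duhamel_coef A p.1 nk.1 nk.2 p.2 a, (nk.2, a))
    | nk <- [seq (n, k) | n <- iota 0 M, k <- iota 0 n.+1], a <- index_enum 'I_d].

Let sum_L M p (F : R * (nat * 'I_d) -> R) : \sum_(u <- L M p) F u =
  \sum_(0 <= n < M) \sum_(0 <= k < n.+1) \sum_a
    F (duhamel_coef A p.1 n k p.2 a, (k, a)).
Proof. by rewrite /L !big_allpairs_dep /index_iota !subn0. Qed.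

Let L_response M t i om : comb (L M (t, i)) W om =
  pseries (fun n => duhamel_series A (deriv_vec om) n i 0) t M.+1.
Proof.
rewrite /comb sum_L duhamel_partial_sum.
do 2! (apply: eq_bigr => ? _); by apply: eq_bigr => a _; rewrite mxE.
Qed.

Let L_cov M p q : quad (deriv_cov kappa) (L M p) (L M q) =
  \sum_(x <- box M) cov_term A kappa p.1 q.1 x.1.+1 x.2.+1 p.2 q.2.
Proof.
rewrite (sum_box (fun n m => cov_term A kappa p.1 q.1 n.+1 m.+1 p.2 q.2)).
rewrite /quad sum_L; apply: eq_bigr => n _.
under [RHS]eq_bigr do rewrite cov_termE.
rewrite [RHS]exchange_big/=; apply: eq_bigr => k _.
under eq_bigr do rewrite sum_L.
rewrite exchange_big/=; apply: eq_bigr => m _.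
rewrite exchange_big/=; apply: eq_bigr => l _.
by [].
Qed.

Let L_cvg p om : D p.1 -> G om ->
  (fun M => comb (L M p) W om) @ \oo --> response_coord p om.
Proof.
case: p => t i /= Dt Gom; rewrite /response_coord /response mem_set//=.
under eq_fun do rewrite L_response.
have := duhamel_cvg (A := A) D_open (deriv_vec_bound Gom) (i := i) Dt.
by rewrite -(cvg_shiftn 1); under eq_fun do rewrite addn1.
Qed.

Lemma measurable_response_coord p : D p.1 -> measurable_fun setT (response_coord p).
Proof.
move=> Dp.
apply: (@measurable_lim_near _ _ _ (fun M om => comb (L M p) W om * \1_G om)).
  apply: nearW => M; apply: measurable_funM; last exact: measurable_indic.
  by apply: measurable_comb => u _; have [] := gaussian_family1 gW (i := u.2) Logic.I.
move=> om; have [Gom|Gom] := pselect (G om).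
  rewrite indicE mem_set// mulr1n; under eq_fun do rewrite mulr1.
  exact: L_cvg.
rewrite indicE memNset// /response_coord /response memNset// mxE.
under eq_fun do rewrite mulr0; exact: cvg_cst.
Qed.

(** The kernels of the partial sums are the square partial sums of the double
    series. *)
Lemma response_family :
  gaussian_family P [set p | D p.1] response_coord response_cov.
Proof.
apply: (gaussian_family_lim (L := L) gW).
- exact: measurable_response_coord.
- by move=> p _; apply: nearW => M.
- move=> p Dp; exists (~` G); split => //; first exact: measurableC.
  by move=> om /= h Gom; apply: h; exact: L_cvg.
- move=> p q Dp Dq; have [C _ hC] := cov_term_has_sum Dp Dq.
  have -> : response_cov p q = C p.2 q.2 by apply/cvg_lim => //; exact: hC.
  by under eq_fun do rewrite L_cov; exact: hC.
Qed.

Lemma solution_gaussian : gaussian_process P D solution.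
Proof.
move=> n t c Dt.
pose l := [seq (c k 0 i, (t k, i)) | k <- index_enum 'I_n, i <- index_enum 'I_d].
pose a := \sum_(k < n) (c k *m (expmx (t k *: A) *m z)) 0 0.
have E : (fun om => \sum_(k < n) (c k *m solution (t k) om) 0 0) =
    (fun om => a + comb l response_coord om).
  apply/funext => om; rewrite /comb big_allpairs_dep /a -big_split/=.
  apply: eq_bigr => k _; rewrite /solution mulmxDr mxE; congr (_ + _).
  by rewrite mxE.
rewrite E; have [_ h] := response_family.
apply: (centered_gaussian_shift a (h l _)) => u /allpairsP[[k i] /= [_ _ ->]] /=.
exact: Dt.
Qed.

Let response1 t i (Dt : D t) :
  centered_gaussian P (response_cov (t, i) (t, i)) (response_coord (t, i)).
Proof. exact: (gaussian_family1 response_family (i := (t, i)) Dt). Qed.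

Let solution_expectation t i : D t ->
  ('E_P[(fun om => solution t om i 0)%R] = ((expmx (t *: A) *m z) i 0)%:E)%E.
Proof.
move=> Dt; have g := response1 i Dt; rewrite unlock.
have ic : P.-integrable setT (fun=> ((expmx (t *: A) *m z) i 0)%:E).
  exact: finite_measure_integrable_cst.
have ir := centered_gaussian_integrable g.
transitivity (\int[P]_om (((expmx (t *: A) *m z) i 0)%:E + (response_coord (t, i) om)%:E))%E.
  by apply: eq_integral => om _; rewrite /solution mxE EFinD.
rewrite integralD// (centered_gaussian_mean g) adde0 integral_cst//.
by rewrite [X in (_ * X)%E](_ : _ = 1%E) ?mule1//; exact: probability_setT.
Qed.

Lemma solution_mean t : D t -> has_mean P (solution t) (expmx (t *: A) *m z).
Proof. by move=> Dt i; exact: solution_expectation. Qed.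

(** The deterministic part drops out of the covariance. *)
Lemma solution_cov t s : D t -> D s -> exists2 C : 'M[R]_d,
  has_sum (fun nm : nat * nat => cov_term A kappa t s nm.1.+1 nm.2.+1) C &
  has_cov P (solution t) (solution s) C.
Proof.
move=> Dt Ds; have [C hC cC] := cov_term_has_sum Dt Ds.
exists C => // i j.
have -> : C i j = response_cov (t, i) (s, j) by apply/esym/cvg_lim.
have [_ <-] := gaussian_family_cov response_family (i := (t, i)) (j := (s, j)) Dt Ds.
rewrite covariance.unlock (solution_expectation i Dt) (solution_expectation j Ds).
rewrite unlock; apply: eq_integral => om _ /=; congr EFin.
have S u k : response_coord (u, k) om = solution u om k 0 - (expmx (u *: A) *m z) k 0.
  by rewrite /solution mxE addrAC subrr add0r.
by rewrite !S.
Qed.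

End solution.

Theorem theorem2p2p10 (R : realType) (dOm : measure_display)
    (Om : measurableType dOm) (P : probability Om R)
    (d : nat) (hd : (0 < d)%N) (A : 'M[R]_d) (z : 'cV[R]_d)
    (rho : \bar R) (hrho : (0 < rho)%E)
    (w : R -> Om -> 'cV[R]_d) (kappa : R -> 'M[R]_d) :
  let TT := time_interval rho (rate A) in
  gaussian_process P TT w ->
  (forall t, TT t -> has_mean P (w t) 0) ->
  stationary_process P TT w ->
  has_autocovariance P TT w kappa ->
  smooth_on (lags TT) kappa ->
  analytic_around0 (lags TT) kappa (2%:E * rho)%E ->
  {ae P, forall om, exists r : \bar R, analytic_around0 TT (w ^~ om) r} ->
  exists x : R -> Om -> 'cV[R]_d,
    [/\ solves_linear_ode P TT A z w x,
        forall y : R -> Om -> 'cV[R]_d,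
          solves_linear_ode P TT A z w y -> indistinguishable P TT y x,
        gaussian_process P TT x,
        forall t, TT t -> has_mean P (x t) (expmx (t *: A) *m z) &
        forall t s, TT t -> TT s -> exists2 C : 'M[R]_d,
          has_sum (fun nm : nat * nat =>
                     cov_term A kappa t s nm.1.+1 nm.2.+1) C &
          has_cov P (x t) (x s) C].
Proof.
move=> TT gw w0 _ wK _ ka [N1 [mN1 PN1 sN1]].
have TT_open := @time_interval_open _ _ A rho.
have TT_ball := @time_interval_ball _ _ A rho.
have [e e0 TTe] := @time_interval_nbhs _ _ A rho hrho.
have kappa_bound q : TT q -> 0 < q -> exists K, forall n i j,
    `|(kappa^`(n))%classic 0 i j / n`!%:R| * (2 * q) ^+ n <= K.
  move=> Tq q0; apply: (analytic_around0_bounded ka); first by rewrite mulr_gt0.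
  exact: time_interval_lt2 hrho _ Tq q0.
(* Off [N1] the paths of the noise are analytic near 0. *)
pose G0 := ~` N1.
have mG0 : measurable G0 by exact: measurableC.
have analytic_w om : G0 om -> exists r : \bar R, analytic_around0 TT (w ^~ om) r.
  by move=> G0om; apply: contrapT => h; apply: G0om; exact: sN1.
have W_family : gaussian_family P setT (noise_deriv w G0) (deriv_cov kappa).
  apply: (@noise_deriv_family _ _ _ P d TT w kappa G0) => //.
  - by rewrite /G0 setCK.
  - by exists e.
  - exact: analytic_around0_entries e0 (lags_nbhs hrho TTe) ka.
  - move=> om /analytic_w [r ar].
    have [r' r'0 hr'] := analytic_around0_entries e0 TTe ar.
    by exists r' => // t tr i; exact: hr'.
  - exact: noise_family gw w0 wK.
have [N2 [mN2 PN2 sN2]] := ae_gbounded W_family TT_open TT_ball kappa_bound.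
(* Off [N2] their Taylor series converge on the whole time interval.  The null
   set N1 `|` N2 is where the response is set to 0. *)
pose G := ~` (N1 `|` N2).
have mN : measurable (N1 `|` N2) by exact: measurableU.
have mG : measurable G by exact: measurableC.
have PG : P (~` G) = 0%E by rewrite /G setCK null_set_setU.
have W_bound om : G om -> forall q, TT q -> 0 < q -> forall i,
    gbounded q (fun n => noise_deriv w G0 (n, i) om / n`!%:R).
  by move=> Gom; apply: contrapT => h; apply: Gom; right; exact: sN2.
have G_G0 om : G om -> G0 om by move=> Gom N1om; apply: Gom; left.
have w_series om t : G om -> TT t -> forall i,
    pseries (fun n => noise_deriv w G0 (n, i) om / n`!%:R) t @ \oo --> w t om i 0.
  move=> Gom Tt i; have G0om := G_G0 _ Gom.
  have [r ar] := analytic_w om G0om.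
  have E k : (fun n => noise_deriv w G0 (n, k) om / n`!%:R) =
      (fun n => ((w ^~ om)^`(n))%classic 0 k 0 / n`!%:R).
    by apply/funext => n; rewrite /noise_deriv mem_set.
  rewrite E; apply: (analytic_around0_extend TT_open ar _ Tt).
  move=> q Tq q0 k l; rewrite (ord1 l) -E; exact: W_bound.
have aeG : {ae P, forall om, G om} by exists (~` G); split => //; exact: measurableC.
pose x := solution A z (noise_deriv w G0) G.
have x_ode om : G om -> forall t, TT t ->
    is_derive t 1 (x ^~ om) (A *m x t om + w t om).
  move=> Gom t Tt.
  exact: (solution_derive A z TT_open W_bound (f := w ^~ om) Gom Tt (w_series om t Gom Tt)).
exists x; split.
- apply: filterS aeG => om Gom; split; first exact: solution0.
  by move=> t Tt; exact: x_ode.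
- move=> y; apply: filterS2 aeG => om Gom [y0 dy] t Tt.
  have yx0 : y 0 om = x 0 om by rewrite y0 /x solution0.
  exact: (linear_ode_unique TT_ball (f := w ^~ om) (x := y ^~ om) (y := x ^~ om)
    yx0 dy (x_ode om Gom) Tt).
- exact: (solution_gaussian A z TT_open W_family kappa_bound mG PG W_bound).
- exact: (solution_mean A z TT_open W_family kappa_bound mG PG W_bound).
- exact: (solution_cov A z TT_open W_family kappa_bound mG PG W_bound).
Qed.
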